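(* Let $F$ be an algebraically closed field of characteristic $2$, and let $n\geq 3$. Let $E$ be the natural simple $F\mathfrak{A}_n$-module (for $n\in\{3,4\}$: any one of the two natural simple $F\mathfrak{A}_n$-modules), and let $Q$ be a vertex of $E$. Then the following hold: (i) If $n$ is odd then $Q$ is conjugate to a Sylow $2$-subgroup of $\mathfrak{A}_{n-3}$, and $E$ has trivial source. (ii) If $n>6$ is even then $Q$ is a Sylow $2$-subgroup of $\mathfrak{A}_n$, and the restriction $\mathrm{Res}_Q^{\mathfrak{A}_n}(E)$ is a source of $E$. (iii) If $n=4$ then $Q$ is the Sylow $2$-subgroup of $\mathfrak{A}_4$, and $E$ has trivial source. If $n=6$ then $Q$ is conjugate to $(\mathfrak{S}_2\times\mathfrak{S}_2\times\mathfrak{S}_2)\cap\mathfrak{A}_6$, and $E$ has a source of dimension $2$.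
   Context: $\mathfrak{S}_n$ and $\mathfrak{A}_n$ denote the symmetric and alternating groups on $\{1,\ldots,n\}$; $\mathfrak{A}_{n-3}$ is embedded in $\mathfrak{A}_n$ as the even permutations fixing $n-2,n-1,n$ (with $\mathfrak{A}_0$ trivial), and $\mathfrak{S}_2\times\mathfrak{S}_2\times\mathfrak{S}_2\leq\mathfrak{S}_6$ is the Young subgroup $\langle(1,2)\rangle\times\langle(3,4)\rangle\times\langle(5,6)\rangle$. All modules are finitely generated right modules. Natural simple module: let $M$ be the natural permutation $F\mathfrak{S}_n$-module with permutation basis $\{\gamma_1,\ldots,\gamma_n\}$. If $n\geq 5$, then $\mathrm{Res}^{\mathfrak{S}_n}_{\mathfrak{A}_n}(M)\cong\mathrm{Ind}_{\mathfrak{A}_{n-1}}^{\mathfrak{A}_n}(F)$ has a unique non-trivial composition factor, which is called the natural simple $F\mathfrak{A}_n$-module; it is the restriction to $\mathfrak{A}_n$ of the unique non-trivial composition factor $D=D^{(n-1,1)}$ of $M$. If $n\in\{3,4\}$, then $\mathrm{Ind}_{\mathfrak{A}_{n-1}}^{\mathfrak{A}_n}(F)$ has exactly two non-trivial composition factors, $E^{(n-1,1)}_{+}$ and $E^{(n-1,1)}_{-}$ (the non-isomorphic simple summands of $\mathrm{Res}^{\mathfrak{S}_n}_{\mathfrak{A}_n}(D^{(n-1,1)})$, where again $D^{(n-1,1)}$ is the unique non-trivial composition factor of $M$), and both are called natural simple modules. Vertices and sources are in the sense of Green: a vertex of an indecomposable $FG$-module $V$ is a subgroup $Q\leq G$ minimal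 subject to $V$ being relatively $Q$-projective, and a source is an indecomposable $FQ$-module $S$ such that $V$ is a direct summand of $\mathrm{Ind}_Q^G(S)$. ''Trivial source'' means that the trivial $FQ$-module is a source. *)

(* Defs.v *)
From HB Require Import structures.
From mathcomp Require Import all_boot all_order all_algebra.
From mathcomp Require Import all_fingroup all_solvable all_field all_character.

Set Implicit Arguments.
Unset Strict Implicit.
Unset Printing Implicit Defensive.

Import GroupScope GRing.Theory.
Local Open Scope ring_scope.

(* A finitely generated right F[G]-module is a matrix representation of G     *)
(* acting by right multiplication on row vectors; isomorphism is mx_rsim.     *)

Section Modules.

Variables (F : fieldType) (gT : finGroupType).
Implicit Types G H Q R : {group gT}.

Lemma trivial_mx_repr (G : {group gT}) :
  mx_repr G (fun _ : gT => 1%:M : 'M[F]_1).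
Proof. by split=> // x y _ _; rewrite mulmx1. Qed.

Definition trivial_repr (G : {group gT}) := MxRepresentation (trivial_mx_repr G).

Definition direct_summand G m n (rU : mx_representation F G m)
    (rV : mx_representation F G n) : Prop :=
  exists rW : representation F G,
    mx_rsim rV (dadd_grepr (Representation rU) rW).

Definition indecomposable G n (rV : mx_representation F G n) : Prop :=
  (0 < n)%N /\
  forall rU rW : representation F G,
    mx_rsim rV (dadd_grepr rU rW) -> rdegree rU = 0%N \/ rdegree rW = 0%N.

Definition composition_factor G m n (rU : mx_representation F G m)
    (rV : mx_representation F G n) : Prop :=
  exists (Vs : seq 'M[F]_n) (compVs : mx_composition_series rV Vs) (i : nat),
    [/\ (last 0 Vs :=: 1%:M)%MS, (i < size Vs)%N
      & mx_rsim (series_repr i compVs) rU].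

(* W (x)_{FH} FG = (+)_i (W (x) t_i), where t_i runs over a right transversal *)
(* of H in G and (w (x) t_i) x = w (t_i x t_j^-1) (x) t_j for the unique j    *)
(* such that H t_i x = H t_j. This is intended only for H \subset G.          *)
Section Induced.

Variables (G H : {group gT}) (m : nat) (rW : mx_representation F H m).

Definition ind_transversal (i : 'I_#|G : H|) : gT := repr (enum_val i).

Definition ind_mx (x : gT) : 'M[F]_(\sum_(i < #|G : H|) m) :=
  \mxblock_(i < #|G : H|, j < #|G : H|)
    (let y := (ind_transversal i * x * (ind_transversal j)^-1)%g in
     if y \in H then rW y else 0 : 'M_m).

Local Notation t := ind_transversal.

Lemma ind_transversal_coset i : H :* t i = enum_val i.
Proof.
rewrite /ind_transversal; have /rcosetsP[g Gg ->] := enum_valP i.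
by rewrite rcoset_repr.
Qed.

Lemma ind_transversal_uniq i j : (t i * (t j)^-1)%g \in H -> i = j.
Proof.
rewrite -mem_rcoset => Hij; apply: enum_val_inj.
by rewrite -!ind_transversal_coset; apply: rcoset_eqP.
Qed.

Lemma ind_transversal_exists i x : x \in G ->
  exists j, (t i * x * (t j)^-1)%g \in H.
Proof.
move=> Gx; have /rcosetsP[g Gg Ei] := enum_valP i.
have Hx : H :* (g * x) \in rcosets H G by apply/rcosetsP; exists (g * x)%g; rewrite ?groupM.
exists (enum_rank_in Hx (H :* (g * x))).
rewrite -mem_rcoset ind_transversal_coset enum_rankK_in //.
by rewrite rcosetM mem_rcoset mulgK -Ei -ind_transversal_coset rcoset_refl.
Qed.

Lemma ind_mx_repr : mx_repr G ind_mx.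
Proof.
split=> [|x y Gx Gy].
  rewrite /ind_mx -mxdiagZ; apply: eq_mxblock => i j /=.
  rewrite mulg1 conform_mx_id; case: (eqVneq i j) => [-> | ne_ij].
    by rewrite mulgV group1 repr_mx1.
  by case: ifP => // /ind_transversal_uniq/eqP; rewrite (negPf ne_ij).
rewrite /ind_mx mul_mxblock; apply: eq_mxblock => i j /=.
have [k0 Hk0] := ind_transversal_exists i Gx.
rewrite (bigD1 k0) //= Hk0 big1 ?addr0 => [|k ne_k].
  have Ez : (t i * (x * y) * (t j)^-1 =
             (t i * x * (t k0)^-1) * (t k0 * y * (t j)^-1))%g.
    by rewrite !mulgA mulgKV.
  rewrite Ez groupMl //; case: ifP => [Hy | _]; last by rewrite mulmx0.
  by rewrite repr_mxM.
case: ifP => [Hk | _]; last by rewrite mul0mx.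
case/eqP: ne_k; apply: ind_transversal_uniq.
have -> : (t k * (t k0)^-1 = (t i * x * (t k)^-1)^-1 * (t i * x * (t k0)^-1))%g.
  by rewrite !invMg !invgK !mulgA !mulgKV.
by rewrite groupM ?groupV.
Qed.

Definition ind_repr := MxRepresentation ind_mx_repr.

End Induced.

Definition relatively_projective G n (rV : mx_representation F G n) Q : Prop :=
  exists m (rW : mx_representation F Q m), direct_summand rV (ind_repr G rW).

Definition is_vertex G n (rV : mx_representation F G n) Q : Prop :=
  [/\ Q \subset G, relatively_projective rV Q
    & forall R, R \subset Q -> relatively_projective rV R -> R :=: Q].

(* To be used when Q is a vertex of rV.                                       *)
Definition is_source G n (rV : mx_representation F G n)
    Q m (rS : mx_representation F Q m) : Prop :=
  indecomposable rS /\ direct_summand rV (ind_repr G rS).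

Definition trivial_source G n (rV : mx_representation F G n) Q : Prop :=
  is_source rV (trivial_repr Q).

Definition conjugate_in G (A B : {set gT}) : Prop :=
  exists2 x, x \in G & A = (B :^ x)%g.

End Modules.

Arguments trivial_repr F {gT} G.

Section SymmetricGroups.

Variable n : nat.

(* The points 1, ..., n are numbered from 0 to n - 1.                         *)

Definition Alt_n_minus_3 : {group 'S_n} :=
  'C_('Alt_('I_n))([set i : 'I_n | n - 3 <= i]%N | 'P)%G.

(* For n = 6 this is <(1,2)> x <(3,4)> x <(5,6)>.                             *)
Definition Young_222 : {group 'S_n} :=
  <<[set tperm i j | i in 'I_n, j in 'I_n
                   & (val i, val j) \in [:: (0, 1); (2, 3); (4, 5)]%N]>>%G.

Variable F : fieldType.

Lemma natural_perm_mx_repr : mx_repr 'Sym_('I_n) (@perm_mx F n).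
Proof. by split=> [|s t _ _]; rewrite (perm_mx1, perm_mxM). Qed.

(* perm_mx s maps the basis row vector delta_mx 0 i to delta_mx 0 (s i).      *)
Definition natural_perm_repr := MxRepresentation natural_perm_mx_repr.

Definition natural_simple d (rE : mx_representation F 'Alt_('I_n) d) : Prop :=
  composition_factor rE (subg_repr natural_perm_repr (Alt_subset 'I_n))
  /\ ~ mx_rsim rE (trivial_repr F [group of 'Alt_('I_n)]).

End SymmetricGroups.

(* Main.v *)
From HB Require Import structures.
Require Import Defs.
From mathcomp Require Import all_boot all_order all_algebra.
From mathcomp Require Import zify ring.
From mathcomp Require Import all_fingroup all_solvable all_field all_character.

(* By Higman's criterion, E is relatively Q-projective if and only if 1 is a  *)
(* relative trace Tr_Q^G(th). For a 2-subgroup P, Mackey's formula writes 1   *)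
(* as a sum of traces Tr_R^P with R = P :&: Q :^ g. Once a vector v and a     *)
(* functional f with v *m f != 0 are found such that v *m Tr_R^P(th) *m f = 0 *)
(* for all proper R, some conjugate of Q contains P. If moreover E is         *)
(* P-projective, then the vertices are the conjugates of P. Here E is taken   *)
(* as the quotient of the sum-zero vectors by the constant ones, and          *)
(* - for n >= 5 odd, v = e_n + e_(n-1) and f = the n-th coordinate are fixed  *)
(*   by a Sylow subgroup P of A_(n-3), and Tr_P^G(f *m v) = 1;                *)
(* - for n >= 8 even, E restricted to the even part B of a subgroup           *)
(*   S_2 x ... x S_2 already has a local endomorphism ring, and no            *)
(*   Tr_R^P(th) with R maximal in a Sylow subgroup P >= B is invertible;      *)
(* - for n = 6, a primitive cube root of unity splits E, restricted to B,     *)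
(*   into two modules of dimension 2 that are conjugate under N(B);           *)
(* - for n = 3 and 4, the Sylow subgroup is normal and acts trivially.        *)

Set Implicit Arguments.
Unset Strict Implicit.
Unset Printing Implicit Defensive.

Import GroupScope GRing.Theory.
Local Open Scope ring_scope.

(** Higman's criterion, in the two directions [direct_summand_ind_rel_trace] and
    [rel_trace_direct_summand_ind], turns projectivity relative to a subgroup into a matrix equation
    Tr(th) = 1. If moreover th = a *m b factors through a module W of the subgroup, then E is a
    summand of the module induced from W, so W is a source as soon as it is indecomposable and the
    subgroup is a vertex. An upper bound for the vertex is therefore an explicit trace identity. The
    lower bound is a scalar test, [relatively_projective_contains]: by Mackey's formula it suffices
    to examine th + th^x for th commuting with a maximal subgroup of the 2-group P. [vertex_conj]
    puts the two bounds together.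

    For n >= 5, [natural_simple_model] replaces the abstract composition factor by the sum-zero
    vectors modulo the constant ones. If n is odd, no nonzero constant vector has sum zero, the test
    vector and functional can be chosen fixed by P, and the two terms of the scalar test are equal,
    so they cancel in characteristic 2 ([vertex_trivial_source]). The trace identity is a count of
    ordered triples of distinct points.

    If n is even, the points are grouped into pairs, and the even products of the swaps of the pairs
    form an elementary abelian group B. With at least four pairs, every endomorphism commuting with
    B is a scalar plus a square-zero map ([even_swaps_local]); hence the restriction to a Sylow
    subgroup is indecomposable, and every trace from a maximal subgroup kills the pair vectors. With
    three pairs the restriction to B splits over a primitive cube root of unity, and one of the
    two-dimensional summands becomes the source ([six_natural_vertex]). For n = 3 and n = 4, a
    normal Sylow subgroup acts trivially on a simple module, which is the setting of
    [normal_sylow_vertex]. *)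

Lemma mulrn_odd (F : fieldType) (V : lmodType F) (u : V) m :
  (2%N \in [pchar F])%R -> odd m -> u *+ m = u.
Proof.
move=> char2 odd_m; rewrite -[m]odd_double_half odd_m add1n mulrS.
by rewrite -scaler_nat -muln2 natrM (pcharf0 char2) mulr0 scale0r addr0.
Qed.

Lemma addvv_pchar2 (F : fieldType) (V : lmodType F) (u : V) :
  (2%N \in [pchar F])%R -> u + u = 0.
Proof. by move=> char2; rewrite -mulr2n -scaler_nat pcharf0 // scale0r. Qed.

(** * Transpositions and groups generated by commuting involutions *)

Section Permutations.

Local Open Scope group_scope.

Lemma tperm_commute (T : finType) (a b c d : T) :
  uniq [:: a; b; c; d] -> commute (tperm a b) (tperm c d).
Proof.
rewrite /= !inE !negb_or -!andbA => /and5P[_ ac ad bc /and3P[bd _ _]].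
by apply/commgP/conjg_fixP; rewrite tpermJ !tpermD // eq_sym.
Qed.

Lemma gen_involutions_abelem (gT : finGroupType) (S : {set gT}) :
    {in S &, forall x y, commute x y} -> {in S, forall x, (x * x = 1)%g} ->
  2.-abelem <<S>>.
Proof.
move=> comS invS; have abS : abelian <<S>>.
  by rewrite abelian_gen; apply/centsP=> x Sx y Sy; apply: comS.
rewrite abelemE // abS; apply/exponentP.
pose H := [set x in <<S>> | x ^+ 2 == 1]%g.
have gH : group_set H.
  apply/group_setP; split=> [|x y]; first by rewrite inE group1 expg1n eqxx.
  rewrite !inE => /andP[Bx /eqP x2] /andP[By /eqP y2]; rewrite groupM //=.
  by rewrite expgMn ?x2 ?y2 ?mulg1 //; apply: (centsP abS).
suff sBH : <<S>> \subset Group gH.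
  by move=> x /(subsetP sBH); rewrite inE => /andP[_ /eqP].
rewrite gen_subG; apply/subsetP=> x Sx; rewrite inE mem_gen //.
by rewrite expgS expg1 invS // eqxx.
Qed.

Lemma tperm2_values (T : finType) (a b c d : T) : uniq [:: a; b; c; d] ->
  let s := (tperm a b * tperm c d)%g in [/\ s a = b, s b = a, s c = d & s d = c].
Proof.
rewrite /= !inE !negb_or -!andbA => /and5P[_ ac ad bc /and3P[bd _ _]].
split; rewrite permM.
- by rewrite tpermL tpermD // eq_sym.
- by rewrite tpermR tpermD // eq_sym.
- by rewrite (tpermD (z := c)) // tpermL.
by rewrite (tpermD (z := d)) // tpermR.
Qed.

Lemma exists_notin (T : finType) (s : seq T) : (size s < #|T|)%N -> exists x, x \notin s.
Proof.
move=> lt_s; apply/existsP; apply: contraTT lt_s; rewrite negb_exists => /forallP s_all.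
rewrite -leqNgt cardT; apply: uniq_leq_size => [|x _]; first exact: enum_uniq.
by have := s_all x; rewrite negbK.
Qed.

End Permutations.

(** * Relative traces *)

Section CosetSum.

Variables (gT : finGroupType) (A : zmodType).
Implicit Types (G H K : {group gT}) (phi : gT -> A).

(* Independent of the representatives if phi is left H-invariant on G. *)
Definition coset_sum (H G : {set gT}) phi := \sum_(C in rcosets H G) phi (repr C).

Definition left_invariant (H G : {set gT}) phi :=
  {in H & G, forall h g, phi (h * g)%g = phi g}.

Lemma eq_coset_sum H G phi psi : H \subset G -> {in G, phi =1 psi} ->
  coset_sum H G phi = coset_sum H G psi.
Proof.
move=> sHG eq_phi; apply: eq_bigr => C /rcosetsP[g Gg ->]; apply: eq_phi.
by have /rcosetP[h Hh ->] := mem_repr_rcoset H g; rewrite groupM // (subsetP sHG).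
Qed.

Lemma coset_sum_orbit (aT : finType) (to : {action gT &-> aT}) G x0 (psi : aT -> A) :
  \sum_(x in orbit to G x0) psi x
    = coset_sum 'C_G[x0 | to] G (fun g => psi (to x0 g)).
Proof.
rewrite orbit_stabilizer ?subsetT // big_imset //=.
by apply: can_in_inj (act_reprK _); rewrite subsetT.
Qed.

(** A K-orbit on the right cosets of H is a double coset, and it is parametrised by the cosets in K
    of the stabiliser of [H :* g]. This is the combinatorial half of Mackey's formula. *)
Lemma coset_sum_orbitRs H G phi K g : K \subset G -> H \subset G -> g \in G ->
    left_invariant H G phi ->
  \sum_(C in orbit 'Rs K (H :* g)) phi (repr C)
    = coset_sum 'C_K[H :* g | 'Rs] K (fun x => phi (g * x)%g).
Proof.
move=> sKG sHG Gg invphi; rewrite (coset_sum_orbit _ _ _ (fun C => phi (repr C))).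
apply: eq_coset_sum; rewrite ?subsetIl // => x Kx /=.
rewrite rcosetE -rcosetM.
have /rcosetP[h Hh ->] := mem_repr_rcoset H (g * x).
by rewrite invphi // groupM // (subsetP sKG).
Qed.

(** Right translation by g permutes the cosets, and left invariance absorbs the change of
    representatives. This is what makes relative traces equivariant. *)
Lemma coset_sum_translate H G phi g : H \subset G -> g \in G ->
    left_invariant H G phi ->
  coset_sum H G (fun x => phi (x * g)%g) = coset_sum H G phi.
Proof.
move=> sHG Gg invphi; rewrite /coset_sum [RHS](reindex (fun C : {set gT} => C :* g)) /=.
  apply: eq_big => [C | C /rcosetsP[x Gx ->]].
    by rewrite -!orbitRs -rcosetE orbit_actr.
  have /rcosetP[h Hh ->] := mem_repr_rcoset H x.
  rewrite -rcosetM; have /rcosetP[h' Hh' ->] := mem_repr_rcoset H (x * g).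
  by rewrite -mulgA (invphi h) ?(invphi h') ?groupM.
by exists (fun C : {set gT} => C :* g^-1) => C _; rewrite -rcosetM ?mulgV ?mulVg rcoset1.
Qed.

(** [H :^ g] is the stabiliser in G of the coset [H :* g], so the claim is the orbit formula based
    at that coset instead of H. *)
Lemma coset_sum_conj H G phi g : H \subset G -> g \in G -> left_invariant H G phi ->
  coset_sum (H :^ g) G (fun x => phi (g * x)%g) = coset_sum H G phi.
Proof.
move=> sHG Gg invphi.
have Eorb : orbit 'Rs G (H :* g) = rcosets H G.
  rewrite orbitRs; apply/setP=> C; apply/rcosetsP/rcosetsP=> -[x Gx ->].
    by exists (g * x)%g; rewrite ?groupM // rcosetM.
  by exists (g^-1 * x)%g; rewrite ?groupM ?groupV // -rcosetM mulKVg.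
rewrite /(coset_sum H) -Eorb (coset_sum_orbitRs (subxx _) sHG Gg invphi).
suff -> : 'C_G[H :* g | 'Rs] = H :^ g by [].
apply/setP=> x; rewrite inE; have [Gx | notGx] /= := boolP (x \in G); last first.
  apply/esym; apply: contraNF notGx; apply: (subsetP _).
  by rewrite -(conjGid Gg) conjSg.
rewrite -[RHS]sub1set -sub_afixRs_norms.
by rewrite !inE !sub1set !inE.
Qed.

(** Every coset [K :* d] is a union of cosets of H, and translation by d carries [rcosets H K] onto
    these. *)
Lemma coset_sum_trans H K G phi : H \subset K -> K \subset G ->
    left_invariant H G phi ->
  coset_sum H G phi
    = coset_sum K G (fun d => coset_sum H K (fun k => phi (k * d)%g)).
Proof.
move=> sHK sKG invphi.
(* [f] sends a coset of H to the coset of K containing it; the sum is split along its fibres. *)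
pose f (C : {set gT}) := K :* repr C.
have fE g : f (H :* g) = K :* g.
  rewrite /f; have /rcosetP[h Hh ->] := mem_repr_rcoset H g.
  by rewrite rcosetM (rcoset_id (subsetP sHK h Hh)).
rewrite /coset_sum (partition_big f (mem (rcosets K G))) /=; last first.
  by move=> C /rcosetsP[g Gg ->]; rewrite fE; apply/rcosetsP; exists g.
apply: eq_bigr => D /rcosetsP[g Gg ->].
have /rcosetP[k Kk ->] := mem_repr_rcoset K g.
have {Kk} [Gd <-] : (k * g)%g \in G /\ K :* (k * g)%g = K :* g.
  split; first by rewrite groupM ?(subsetP sKG k).
  by rewrite rcosetM (rcoset_id Kk).
move: (k * g)%g Gd => d Gd {k g Gg}.
rewrite (reindex (fun C : {set gT} => C :* d)) /=; last first.
  by exists (fun C : {set gT} => C :* d^-1) => C _; rewrite -rcosetM ?mulgV ?mulVg rcoset1.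
apply: eq_big => [C | C]; last first.
  case/andP=> /rcosetsP[g Gg E]; rewrite E fE => _.
  have [c def_c]: exists c, C = H :* c.
    by exists (g * d^-1)%g; rewrite rcosetM -E -rcosetM mulgV rcoset1.
  rewrite def_c in E *; rewrite -rcosetM in E.
  have Gc : c \in G.
    have /rcosetP[h Hh def_cd] : (c * d)%g \in H :* g by rewrite -E rcoset_refl.
    by rewrite -(groupMr c Gd) def_cd groupM // (subsetP sKG) // (subsetP sHK).
  have /rcosetP[h Hh ->] := mem_repr_rcoset H g.
  have /rcosetP[h' Hh' ->] := mem_repr_rcoset H c.
  rewrite -mulgA (invphi h g) // (invphi h' (c * d)%g) ?groupM //.
  have /rcosetP[h'' Hh'' ->] : g \in H :* (c * d) by rewrite E rcoset_refl.
  by rewrite (invphi h'' (c * d)%g) ?groupM.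
apply/andP/idP=> [[/rcosetsP[g Gg E] /eqP]|/rcosetsP[k Kk ->]].
  rewrite E fE => /esym eqK.
  have {E} ->: C = H :* (g * d^-1) by rewrite rcosetM -E -rcosetM mulgV rcoset1.
  apply/rcosetsP; exists (g * d^-1)%g => //.
  by rewrite -mem_rcoset eqK rcoset_refl.
rewrite -rcosetM fE (rcosetM K) (rcoset_id Kk); split=> //.
by apply/rcosetsP; exists (k * d)%g; rewrite // groupM // (subsetP sKG).
Qed.

Lemma coset_sum_const H K G phi : H \subset K -> K \subset G ->
  left_invariant K G phi -> coset_sum H G phi = coset_sum K G phi *+ #|K : H|.
Proof.
move=> sHK sKG invphi; rewrite (coset_sum_trans sHK sKG) => [|h g Hh Gg]; last first.
  by rewrite invphi // (subsetP sHK).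
rewrite -sumrMnl; apply: eq_bigr => D /rcosetsP[g Gg ->].
rewrite -sumr_const; apply: eq_bigr => C /rcosetsP[k Kk ->].
have /rcosetP[k' Kk' ->] := mem_repr_rcoset K g.
have /rcosetP[h Hh ->] := mem_repr_rcoset H k.
by rewrite !invphi ?groupM ?(subsetP sHK h) // (subsetP sKG).
Qed.

Lemma coset_sum_index2 H G phi x : H \subset G -> #|G : H| = 2 ->
    x \in G -> x \notin H -> left_invariant H G phi ->
  coset_sum H G phi = phi 1%g + phi x.
Proof.
move=> sHG iHG Gx notHx invphi.
have Hx : H :* x != H.
  by apply: contra notHx => /eqP <-; rewrite rcoset_refl.
have E : rcosets H G = [set (H : {set gT}); H :* x].
  apply/eqP; rewrite eq_sym eqEcard; have -> : #|rcosets H G| = 2 by [].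
  rewrite cards2 eq_sym Hx andbT; apply/subsetP=> C; rewrite !inE.
  case/orP=> /eqP->; apply/rcosetsP; last by exists x.
  by exists 1%g; rewrite ?rcoset1.
rewrite /coset_sum E big_setU1 ?inE 1?eq_sym //= big_set1 repr_group.
have /rcosetP[h Hh ->] := mem_repr_rcoset H x.
by rewrite invphi.
Qed.

End CosetSum.

Section Retract.

Variables (F : fieldType) (gT : finGroupType) (G : {group gT}).

(** A is a split embedding with retraction B, so the space is the direct sum of the image of A and
    the kernel of B, both of which are submodules. *)
Lemma retract_direct_summand m n (rU : mx_representation F G m)
    (rV : mx_representation F G n) (A : 'M_(m, n)) (B : 'M_(n, m)) :
    {in G, forall x, rU x *m A = A *m rV x} ->
    {in G, forall x, rV x *m B = B *m rU x} ->
  A *m B = 1%:M -> direct_summand rU rV.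
Proof.
move=> homA homB AB1.
have modA : mxmodule rV <<A>>%MS.
  apply/mxmoduleP=> x Gx; rewrite !genmxE (eqmxMr _ (genmxE A)).
  by rewrite -homA // submxMl.
have modK : mxmodule rV (kermx B).
  apply/mxmoduleP=> x Gx; apply/sub_kermxP.
  by rewrite -mulmxA homB // mulmxA mulmx_ker mul0mx.
have sumAK : (<<A>> + kermx B :=: 1%:M)%MS.
  apply/eqmxP; rewrite submx1 /= -[1%:M](subrK (B *m A)) addrC.
  rewrite addmx_sub_adds ?genmxE ?submxMl //.
  by apply/sub_kermxP; rewrite mulmxBl mul1mx -mulmxA AB1 mulmx1 subrr.
have dxAK : mxdirect (<<A>> + kermx B).
  apply/mxdirect_addsP/eqP; rewrite -submx0.
  apply/rV_subP=> v; rewrite sub_capmx genmxE => /andP[/submxP[w ->]] /sub_kermxP.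
  by rewrite -mulmxA AB1 mulmx1 => ->; rewrite mul0mx sub0mx.
exists (Representation (submod_repr modK)).
have simU : mx_rsim rU (submod_repr modA).
  have rankA : \rank <<A>> = m.
    by rewrite genmxE; apply/eqP/row_freeP; exists B.
  exists (in_submod <<A>>%MS A).
  - by rewrite rankA.
  - apply/row_freeP; exists (val_submod 1%:M *m B).
    rewrite mulmxA -val_submodE in_submodK ?genmxE //.
  - move=> x Gx; have sAA : (A <= <<A>>)%MS by rewrite genmxE.
    apply: etrans (in_submodJ modA x sAA).
    by rewrite -(congr1 (in_submod _) (homA x Gx)) in_submodE [RHS]in_submodE mulmxA.
have modW := mxmodule1 rV.
apply: mx_rsim_trans (@mx_rsim_dadd F gT G n rV _ _ 1%:M (Representation rU)
  (Representation (submod_repr modK)) modA modK modW sumAK dxAK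
  (mx_rsim_sym simU) (mx_rsim_refl _)).
exact/mx_rsim_sym/rsim_submod1.
Qed.

Lemma direct_summand_retract m n (rU : mx_representation F G m)
    (rV : mx_representation F G n) :
    direct_summand rU rV ->
  exists (A : 'M_(m, n)) (B : 'M_(n, m)),
    [/\ {in G, forall x, rU x *m A = A *m rV x},
        {in G, forall x, rV x *m B = B *m rU x} & A *m B = 1%:M].
Proof.
case=> -[k rW] [/= f def_n free_f hom_f]; subst n.
have f_unit : f \in unitmx by rewrite -row_free_unit.
exists (row_mx 1%:M 0 *m invmx f), (f *m col_mx 1%:M 0); split=> [x Gx | x Gx |].
- have homVf : block_mx (rU x) 0 0 (rW x) *m invmx f = invmx f *m rV x.
    by rewrite -[rV x](mulmxK f_unit) hom_f // !mulmxA mulVmx // mul1mx.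
  rewrite -mulmxA -homVf !mulmxA; congr (_ *m _).
  by rewrite mul_row_block mul_mx_row !mul0mx !mul1mx !mulmx1 !mulmx0 !addr0.
- rewrite mulmxA hom_f // -!mulmxA; congr (_ *m _).
  by rewrite mul_block_col mul_col_mx !mul0mx !mul1mx !mulmx1 !mulmx0 !addr0.
by rewrite mulmxA mulmxKV // mul_row_col !mul1mx mulmx0 addr0.
Qed.

End Retract.

Section RelativeTrace.

Variables (F : fieldType) (gT : finGroupType) (G : {group gT}).
Variables (n : nat) (rV : mx_representation F G n).
Implicit Types (H K L : {group gT}) (th : 'M[F]_n).

(** The right conjugation action of G on linear endomorphisms, matrices acting on row vectors.
    Equivariance under a subgroup is invariance under this action ([equivariantP]). *)
Definition mxconj th g := rV g^-1%g *m th *m rV g.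

Definition equivariant (H : {set gT}) th := {in H, forall h, rV h *m th = th *m rV h}.

Definition rel_trace (H K : {set gT}) th := coset_sum H K (mxconj th).

Lemma mxconjM th g h : g \in G -> h \in G ->
  mxconj th (g * h)%g = mxconj (mxconj th g) h.
Proof. by move=> Gg Gh; rewrite /mxconj invMg !repr_mxM ?groupV // !mulmxA. Qed.

Lemma mxconj_equivariant H th h : H \subset G -> equivariant H th -> h \in H ->
  mxconj th h = th.
Proof.
move=> sHG eqv Hh; rewrite /mxconj -mulmxA -eqv // mulmxA.
by rewrite -repr_mxM ?groupV ?(subsetP sHG) // mulVg repr_mx1 mul1mx.
Qed.

Lemma equivariantP H th : H \subset G ->
  equivariant H th <-> {in H, forall h, mxconj th h = th}.
Proof.
move=> sHG; split=> [eqv h|eqv h Hh]; first exact: mxconj_equivariant eqv.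
rewrite -{1}(eqv h Hh) /mxconj !mulmxA -repr_mxM ?groupV ?(subsetP sHG) //.
by rewrite mulgV repr_mx1 mul1mx.
Qed.

Lemma equivariantS H K th : H \subset K -> equivariant K th -> equivariant H th.
Proof. by move=> sHK eqv h Hh; apply: eqv; apply: (subsetP sHK). Qed.

Lemma left_invariant_mxconj H th : H \subset G -> equivariant H th ->
  left_invariant H G (mxconj th).
Proof.
move=> sHG eqv h g Hh Gg.
by rewrite mxconjM ?(subsetP sHG h) // (mxconj_equivariant sHG eqv Hh).
Qed.

Lemma left_invariantS (A : zmodType) H K (phi : gT -> A) :
  K \subset G -> left_invariant H G phi -> left_invariant H K phi.
Proof. by move=> sKG inv h g Hh Kg; rewrite inv // (subsetP sKG). Qed.

Lemma mxconj_sum I r (P : pred I) (E : I -> 'M_n) g :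
  mxconj (\sum_(i <- r | P i) E i) g = \sum_(i <- r | P i) mxconj (E i) g.
Proof. by rewrite /mxconj mulmx_sumr mulmx_suml. Qed.

Lemma mxconj_rel_trace H K th g : H \subset K -> K \subset G -> g \in G ->
  mxconj (rel_trace H K th) g = coset_sum H K (fun k => mxconj th (k * g)%g).
Proof.
move=> sHK sKG Gg; rewrite /rel_trace /coset_sum mxconj_sum.
apply: eq_bigr => C /rcosetsP[k Kk ->]; rewrite mxconjM //.
have /rcosetP[h Hh ->] := mem_repr_rcoset H k.
by rewrite (subsetP sKG) // groupM // (subsetP sHK).
Qed.

Lemma equivariant_rel_trace H K th : H \subset K -> K \subset G ->
  equivariant H th -> equivariant K (rel_trace H K th).
Proof.
move=> sHK sKG eqv; apply/equivariantP=> // k Kk.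
rewrite mxconj_rel_trace ?(subsetP sKG) //; apply: coset_sum_translate => //.
exact/(left_invariantS sKG)/(left_invariant_mxconj (subset_trans sHK sKG)).
Qed.

Lemma rel_trace_trans H K L th : H \subset K -> K \subset L -> L \subset G ->
  equivariant H th -> rel_trace H L th = rel_trace K L (rel_trace H K th).
Proof.
move=> sHK sKL sLG eqv; have sHG := subset_trans (subset_trans sHK sKL) sLG.
rewrite /rel_trace (coset_sum_trans sHK sKL); last first.
  exact/(left_invariantS sLG)/left_invariant_mxconj.
apply: eq_coset_sum => // g Gg; rewrite -mxconj_rel_trace ?(subsetP sLG) //.
exact: subset_trans sLG.
Qed.

Lemma rel_trace_index2 H K th x : H \subset K -> K \subset G -> #|K : H| = 2 ->
    x \in K -> x \notin H -> equivariant H th ->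
  rel_trace H K th = th + mxconj th x.
Proof.
move=> sHK sKG iKH Kx notHx eqv; rewrite /rel_trace (coset_sum_index2 sHK iKH Kx) //.
  by rewrite /mxconj invg1 repr_mx1 mul1mx mulmx1.
exact/(left_invariantS sKG)/(left_invariant_mxconj (subset_trans sHK sKG)).
Qed.

Lemma rel_trace1 H : H \subset G -> rel_trace H G 1%:M = #|G : H|%:R%:M.
Proof.
move=> sHG; rewrite /rel_trace /coset_sum (eq_bigr (fun=> 1%:M)) => [|C].
  by rewrite sumr_const raddfMn.
case/rcosetsP=> g Gg ->; have /rcosetP[h Hh ->] := mem_repr_rcoset H g.
rewrite /mxconj mulmx1 -repr_mxM ?groupV ?groupM ?(subsetP sHG h) //.
by rewrite mulVg repr_mx1.
Qed.

Lemma sum_ind_transversal H (A : zmodType) (phi : gT -> A) :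
  \sum_(i < #|G : H|) phi (ind_transversal i) = coset_sum H G phi.
Proof. by rewrite /coset_sum [RHS]big_enum_val. Qed.

Section Higman.

Variables (H : {group gT}) (m : nat) (rW : mx_representation F H m).
Hypothesis sHG : H \subset G.

Local Notation t := (@ind_transversal gT G H).

Let E (i j : 'I_#|G : H|) (x : gT) : 'M[F]_m :=
  if (t i * x * (t j)^-1)%g \in H then rW (t i * x * (t j)^-1)%g else 0.

Let Gt i : t i \in G.
Proof.
have /rcosetsP[g Gg Ei] := enum_valP i; rewrite /ind_transversal Ei.
by have /rcosetP[h Hh ->] := mem_repr_rcoset H g; rewrite groupM // (subsetP sHG).
Qed.

(** The split embedding A and its retraction B decompose into blocks indexed by the cosets.
    Equivariance determines all blocks from those at the coset H itself, by translation with the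
    transversal, so A *m B = 1 reads as the relative trace of the product of these two blocks. *)
Lemma direct_summand_ind_rel_trace :
    direct_summand rV (ind_repr G rW) ->
  exists2 th, equivariant H th & rel_trace H G th = 1%:M.
Proof.
case/direct_summand_retract=> A [B [homA homB AB1]].
have H_coset : (H : {set gT}) \in rcosets H G.
  by apply/rcosetsP; exists 1%g; rewrite ?rcoset1.
(* The representative chosen by [repr] in a subgroup is 1, so the block at [i0] needs no
   translation. *)
pose i0 := enum_rank_in H_coset H.
have ti0 : t i0 = 1%g by rewrite /ind_transversal enum_rankK_in // repr_group.
pose a j : 'M_(n, m) := submxrow A j; pose b i : 'M_(m, n) := submxcol B i.
have aE x j : x \in G -> rV x *m a j = \sum_i a i *m E i j x.
  move=> Gx; rewrite mul_submxrow homA // -{1}[A]submxrowK.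
  by rewrite /= /ind_mx mul_mxrow_mxblock mxrowK.
have bE x i : x \in G -> b i *m rV x = \sum_j E i j x *m b j.
  move=> Gx; rewrite submxcol_mul -homB // -{1}[B]submxcolK.
  by rewrite /= /ind_mx mul_mxblock_mxrow mxcolK.
have aj j : rV (t j)^-1%g *m a i0 = a j.
  rewrite aE ?groupV // (bigD1 j) //= big1 => [|i ne_ij].
    by rewrite /E ti0 mulgV invg1 mulg1 group1 repr_mx1 mulmx1 addr0.
  rewrite /E ti0 invg1 mulg1; case: ifP => [/ind_transversal_uniq/eqP|].
    by rewrite (negPf ne_ij).
  by rewrite mulmx0.
have bj j : b i0 *m rV (t j) = b j.
  rewrite bE // (bigD1 j) //= big1 => [|i ne_ij].
    by rewrite /E ti0 mul1g mulgV group1 repr_mx1 mul1mx addr0.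
  rewrite /E ti0 mul1g; case: ifP => [/ind_transversal_uniq/esym/eqP|].
    by rewrite (negPf ne_ij).
  by rewrite mul0mx.
exists (a i0 *m b i0) => [h Hh|].
  have Gh := subsetP sHG h Hh.
  have Eh : E i0 i0 h = rW h by rewrite /E ti0 mul1g invg1 mulg1 Hh.
  have ne_i0 i : i != i0 -> t i \notin H.
    by apply: contra => Hi; apply/eqP/ind_transversal_uniq; rewrite ti0 invg1 mulg1.
  rewrite mulmxA aE // -mulmxA bE // (bigD1 i0) //= [in RHS](bigD1 i0) //= !big1.
  - by rewrite !addr0 mulmxA.
  - move=> i /ne_i0; rewrite /E ti0 mul1g groupMl // groupV => /negPf->.
    by rewrite mul0mx.
  move=> i /ne_i0; rewrite /E ti0 invg1 mulg1 groupMr // => /negPf->.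
  by rewrite mulmx0.
rewrite /rel_trace -sum_ind_transversal -AB1 -[A]submxrowK -[B]submxcolK.
rewrite mul_mxrow_mxcol; apply: eq_bigr => j _.
by rewrite /mxconj -[LHS]mulmxA -mulmxA bj mulmxA aj.
Qed.

(** The translates of a and b by the transversal are assembled into an embedding into the induced
    module and a retraction. As a and b may factor through any module W of H, the lemma also
    produces sources smaller than the restriction of E. *)
Lemma rel_trace_direct_summand_ind (a : 'M_(n, m)) (b : 'M_(m, n)) :
    {in H, forall h, rV h *m a = a *m rW h} ->
    {in H, forall h, rW h *m b = b *m rV h} ->
  rel_trace H G (a *m b) = 1%:M -> direct_summand rV (ind_repr G rW).
Proof.
move=> homa homb tr1.
pose A := \mxrow_(j < #|G : H|) (rV (t j)^-1%g *m a).
pose B := \mxcol_(j < #|G : H|) (b *m rV (t j)).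
apply: (@retract_direct_summand _ _ _ _ _ _ _ A B) => [x Gx | x Gx |].
- rewrite /= /ind_mx mul_mxrow_mxblock mul_mxrow; apply: eq_mxrow => j /=.
  have [i Hi] := ind_transversal_exists j (groupVr Gx).
  have {}Hi : (t i * x * (t j)^-1)%g \in H by rewrite -groupV !invMg !invgK mulgA.
  rewrite (bigD1 i) //= Hi big1 ?addr0 => [|k ne_ki].
    rewrite -mulmxA -homa // !mulmxA -!repr_mxM ?groupM ?groupV //.
    by rewrite !mulgA mulVg mul1g.
  case: ifP => [Hk | _]; last by rewrite mulmx0.
  case/eqP: ne_ki; apply: ind_transversal_uniq.
  have -> : (t k * (t i)^-1 = (t k * x * (t j)^-1) * (t i * x * (t j)^-1)^-1)%g.
    by rewrite !invMg !invgK !mulgA mulgKV mulgK.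
  by rewrite groupM ?groupV.
- rewrite /= /ind_mx mul_mxblock_mxrow mxcol_mul; apply: eq_mxcol => i /=.
  have [j Hj] := ind_transversal_exists i Gx.
  rewrite (bigD1 j) //= Hj big1 ?addr0 => [|k ne_kj].
    rewrite mulmxA homb // -!mulmxA -!repr_mxM ?groupM ?groupV //.
    by rewrite mulgKV.
  case: ifP => [Hk | _]; last by rewrite mul0mx.
  case/eqP: ne_kj; apply: ind_transversal_uniq.
  have -> : (t k * (t j)^-1 = (t i * x * (t k)^-1)^-1 * (t i * x * (t j)^-1))%g.
    by rewrite !invMg !invgK !mulgA !mulgKV.
  by rewrite groupM ?groupV.
rewrite mul_mxrow_mxcol -tr1 /rel_trace -sum_ind_transversal.
by apply: eq_bigr => j _; rewrite /mxconj !mulmxA.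
Qed.

End Higman.

End RelativeTrace.

(** * Vertices and sources *)

Section Vertex.

Variables (F : fieldType) (gT : finGroupType) (G : {group gT}).
Variables (n : nat) (rV : mx_representation F G n).
Implicit Types (P Q R : {group gT}) (th : 'M[F]_n).

(** If x stabilises [Q :* g] then g x = q g for some q in Q, and th^(g x) = th^(q g) = th^g. *)
Lemma equivariant_mxconj_stab Q P th g :
    Q \subset G -> P \subset G -> g \in G -> equivariant rV Q th ->
  equivariant rV 'C_P[Q :* g | 'Rs] (mxconj rV th g).
Proof.
move=> sQG sPG Gg eqv; apply/(equivariantP rV) => [|x].
  by rewrite (subset_trans _ sPG) ?subsetIl.
case/setIP=> Px /astab1P /=; rewrite rcosetE -rcosetM => Egx.
have Gx := subsetP sPG x Px.
have /rcosetP[q Qq Eq] : (g * x)%g \in Q :* g by rewrite -Egx rcoset_refl.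
rewrite -mxconjM // Eq mxconjM ?(subsetP sQG q) //.
by rewrite (mxconj_equivariant sQG eqv Qq).
Qed.

(** The contribution of one double coset in Mackey's formula. *)
Lemma rel_trace_orbit Q P th g :
    Q \subset G -> P \subset G -> g \in G -> equivariant rV Q th ->
  \sum_(C in orbit 'Rs P (Q :* g)) mxconj rV th (repr C)
    = rel_trace rV 'C_P[Q :* g | 'Rs] P (mxconj rV th g).
Proof.
move=> sQG sPG Gg eqv; rewrite (coset_sum_orbitRs sPG sQG Gg); last first.
  exact: left_invariant_mxconj.
apply: eq_coset_sum; rewrite ?subsetIl // => x Px.
by rewrite mxconjM // (subsetP sPG).
Qed.

(* A trace from a proper subgroup of P factors through a maximal subgroup R,  *)
(* of index 2, from which it has the form th + th^x.                          *)
Lemma relatively_projective_contains P Q (v : 'rV_n) (f : 'cV_n) :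
    P \subset G -> Q \subset G -> 2.-group P -> v *m f != 0 ->
    (forall R x th, maximal R P -> x \in P -> x \notin R -> equivariant rV R th ->
       v *m (th + mxconj rV th x) *m f = 0) ->
    relatively_projective rV Q ->
  exists2 g, g \in G & P \subset Q :^ g.
Proof.
move=> sPG sQG pP nz_vf key [m [rW /(direct_summand_ind_rel_trace sQG)[th eqv tr1]]].
have [/exists_inP[g Gg sPQ] | no_g] := boolP [exists g in G, P \subset Q :^ g].
  by exists g.
case/eqP: nz_vf; rewrite -[v]mulmx1 -tr1 /rel_trace /coset_sum.
have actP : [acts P, on rcosets Q G | 'Rs].
  exact: subset_trans sPG (actsRs_rcosets Q G).
rewrite (set_partition_big _ (orbit_partition actP)) /=.
rewrite mulmx_sumr mulmx_suml big1 // => O /imsetP[C /rcosetsP[g Gg ->] ->].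
rewrite rel_trace_orbit //.
(* If the stabiliser were all of P, then P would fix the coset [Q :* g], that is, P would lie in
   [Q :^ g]. *)
have : 'C_P[Q :* g | 'Rs] \proper P.
  rewrite properEneq subsetIl andbT; apply: contra no_g => /eqP/setIidPl fixP.
  apply/exists_inP; exists g => //; rewrite -sub_afixRs_norms.
  by apply/afixP=> x Px; apply/astab1P; apply: (subsetP fixP).
case/properP=> sSP [y Py notSy].
case: (maximal_exists sSP) => [E | [R maxR sSR]].
  by case/negP: notSy; rewrite E.
have sRP := proper_sub (maxgroupp maxR).
have [x Px notRx] : exists2 x, x \in P & x \notin R.
  by have /properP[_] := maxgroupp maxR.
have eqS := equivariant_mxconj_stab sQG sPG Gg eqv.
rewrite (rel_trace_trans sSR sRP sPG eqS).
rewrite (@rel_trace_index2 _ _ _ _ _ R P _ x) //.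
- by apply: (key R) => //; apply: equivariant_rel_trace (subset_trans sRP sPG) eqS.
- by rewrite (p_maximal_index pP maxR).
exact: equivariant_rel_trace (subset_trans sRP sPG) eqS.
Qed.

Lemma conj_mx_repr P m (rW : mx_representation F P m) g :
  mx_repr (P :^ g)%G (fun x => rW (x ^ g^-1)%g).
Proof.
split=> [|x y /= Px Py]; first by rewrite conj1g repr_mx1.
by rewrite conjMg repr_mxM // -mem_conjg.
Qed.

Definition conj_repr P m (rW : mx_representation F P m) g :=
  MxRepresentation (conj_mx_repr rW g).

Lemma rel_trace_conj P th g : P \subset G -> g \in G -> equivariant rV P th ->
  rel_trace rV (P :^ g) G (mxconj rV th g) = rel_trace rV P G th.
Proof.
move=> sPG Gg eqv; rewrite -[RHS](coset_sum_conj sPG Gg); last first.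
  exact: left_invariant_mxconj.
apply: (@eq_coset_sum _ _ (P :^ g)%G) => [|x Gx]; last by rewrite mxconjM.
by rewrite /= -(conjGid Gg) conjSg.
Qed.

Section Transport.

Variables (P : {group gT}) (m : nat) (rW : mx_representation F P m).
Variables (a : 'M[F]_(n, m)) (b : 'M[F]_(m, n)).
Hypotheses (sPG : P \subset G)
  (homa : {in P, forall h, rV h *m a = a *m rW h})
  (homb : {in P, forall h, rW h *m b = b *m rV h})
  (tr1 : rel_trace rV P G (a *m b) = 1%:M).

(** Replacing a and b by their translates under g conjugates a *m b, and [rel_trace_conj] says that
    the trace does not change. *)
Lemma direct_summand_ind_conj g (rX : mx_representation F (P :^ g)%G m) :
    g \in G -> {in P, forall x, rX (x ^ g)%g = rW x} ->
  direct_summand rV (ind_repr G rX).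
Proof.
move=> Gg rXE; have sPgG : (P :^ g)%G \subset G by rewrite /= -(conjGid Gg) conjSg.
apply: (rel_trace_direct_summand_ind sPgG (a := rV g^-1%g *m a) (b := b *m rV g)).
- move=> _ /imsetP[x Px ->]; have Gx := subsetP sPG x Px.
  rewrite rXE // -mulmxA -homa // !mulmxA -!repr_mxM ?groupM ?groupV //.
  by rewrite conjgE !mulgA mulgK.
- move=> _ /imsetP[x Px ->]; have Gx := subsetP sPG x Px.
  rewrite rXE // mulmxA homb // -!mulmxA -!repr_mxM ?groupM ?groupV //.
  by rewrite conjgE mulKVg.
rewrite -tr1 -[RHS](rel_trace_conj sPG Gg) => [|x Px]; last first.
  by rewrite mulmxA homa // -!mulmxA homb.
by rewrite /mxconj !mulmxA.
Qed.

Lemma relatively_projective_conj g : g \in G -> relatively_projective rV (P :^ g)%G.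
Proof.
move=> Gg; exists m, (conj_repr rW g); apply: direct_summand_ind_conj => //.
by move=> x Px; rewrite /= conjgK.
Qed.

(** The scalar test puts P inside a conjugate of Q, so a conjugate of P lies in Q; E is projective
    relative to that conjugate, and minimality of the vertex gives equality. *)
Lemma vertex_conj Q (v : 'rV_n) (f : 'cV_n) :
    2.-group P -> v *m f != 0 ->
    (forall R x th, maximal R P -> x \in P -> x \notin R -> equivariant rV R th ->
       v *m (th + mxconj rV th x) *m f = 0) ->
    is_vertex rV Q ->
  exists2 g, g \in G & Q :=: P :^ g.
Proof.
move=> pP nz_vf key [sQG projQ minQ].
have [g Gg sPQ] := relatively_projective_contains sPG sQG pP nz_vf key projQ.
exists g^-1%g; rewrite ?groupV //; apply/esym.
apply: (minQ (P :^ g^-1)%G); first by rewrite sub_conjgV.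
by apply: relatively_projective_conj; rewrite groupV.
Qed.

End Transport.

Lemma indecomposable_degree1 P (rW : mx_representation F P 1) : indecomposable rW.
Proof.
split=> // rU rX [/= f def_1 _ _].
case: (rdegree rU) def_1 => [|k]; first by left.
by rewrite addSn => -[/esym/eqP]; rewrite addn_eq0 => /andP[_ /eqP->]; right.
Qed.

(** As x fixes v and f, the scalars v th f and v th^x f agree and cancel in characteristic 2,
    whatever th is. As P fixes f and w, the product f *m w factors through the trivial module. *)
Lemma vertex_trivial_source P Q (v w : 'rV_n) (f : 'cV_n) :
    (2%N \in [pchar F])%R -> P \subset G -> 2.-group P -> v *m f != 0 ->
    {in P, forall x, v *m rV x = v} -> {in P, forall x, w *m rV x = w} ->
    {in P, forall x, rV x *m f = f} ->
    rel_trace rV P G (f *m w) = 1%:M -> is_vertex rV Q ->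
  (exists2 g, g \in G & Q :=: P :^ g) /\ trivial_source rV Q.
Proof.
move=> char2 sPG pP nz_vf fix_v fix_w fix_f tr1 vxQ.
have homf : {in P, forall h, rV h *m f = f *m trivial_repr F P h}.
  by move=> h Ph; rewrite fix_f // mulmx1.
have homw : {in P, forall h, trivial_repr F P h *m w = w *m rV h}.
  by move=> h Ph; rewrite fix_w // mul1mx.
have key R x th : maximal R P -> x \in P -> x \notin R -> equivariant rV R th ->
    v *m (th + mxconj rV th x) *m f = 0.
  move=> _ Px _ _; rewrite mulmxDr mulmxDl.
  rewrite /mxconj !mulmxA fix_v ?groupV // -[_ *m rV x *m f]mulmxA fix_f //.
  by rewrite -mulr2n -scaler_nat pcharf0 // scale0r.
have [g Gg defQ] := vertex_conj sPG homf homw tr1 pP nz_vf key vxQ.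
split; first by exists g.
split; first exact: indecomposable_degree1.
have {}defQ : Q = (P :^ g)%G by apply: group_inj.
by subst Q; apply: (direct_summand_ind_conj sPG homf homw tr1 Gg).
Qed.

Lemma rel_trace_mulr P th u : P \subset G -> equivariant rV G u ->
  rel_trace rV P G (th *m u) = rel_trace rV P G th *m u.
Proof.
move=> sPG eqv; rewrite /rel_trace /coset_sum mulmx_suml; apply: eq_bigr => C.
case/rcosetsP=> g Gg ->; have /rcosetP[h Hh ->] := mem_repr_rcoset P g.
by rewrite /mxconj -!mulmxA eqv // groupM // (subsetP sPG).
Qed.

(** A normal 2-subgroup acts trivially on a simple module in characteristic 2. A rank-one map of
    trace 1 then has relative trace T of trace |G : P|, which is odd; so T is nonzero, hence
    invertible by Schur's lemma, and can be normalised to 1. *)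
Lemma normal_sylow_vertex P Q :
    (2%N \in [pchar F])%R -> mx_irreducible rV -> 2.-Sylow(G) P -> P <| G ->
    is_vertex rV Q ->
  Q :=: P /\ trivial_source rV Q.
Proof.
move=> char2 irrV sylP nsPG vxQ; have sPG := normal_sub nsPG.
have pP := pHall_pgroup sylP.
have fixP : {in P, forall x, rV x = 1%:M}.
  move=> x Px.
  have /subsetP/(_ x) := pcore_sub_rker_mx_irr_pchar char2 irrV.
  rewrite (subsetP (pcore_max pP nsPG)) // => /(_ isT)/rkerP[].
  by [].
have n_gt0 : (0 < n)%N by case/mx_irrP: irrV.
pose i0 := Ordinal n_gt0.
pose v : 'rV[F]_n := delta_mx 0 i0; pose f : 'cV[F]_n := delta_mx i0 0.
have vf1 : v *m f = 1%:M by rewrite mul_delta_mx; apply/matrixP=> i j; rewrite !ord1 !mxE.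
have eqvP th : equivariant rV P th by move=> x Px; rewrite fixP // mul1mx mulmx1.
pose T := rel_trace rV P G (f *m v).
have eqvT : equivariant rV G T by apply: equivariant_rel_trace.
have trT : \tr T = #|G : P|%:R.
  rewrite /T /rel_trace /coset_sum raddf_sum (eq_bigr (fun=> 1)) ?sumr_const //.
  move=> C /rcosetsP[g Gg ->]; have /rcosetP[h Hh ->] := mem_repr_rcoset P g.
  have Ghg : (h * g)%g \in G by rewrite groupM // (subsetP sPG).
  rewrite /= /mxconj mxtrace_mulC mulmxA -repr_mxM ?groupV // mulgV repr_mx1 mul1mx.
  by rewrite mxtrace_mulC vf1 mxtrace1.
have nzT : T != 0.
  apply/eqP=> T0; have := trT; rewrite T0 mxtrace0 => /esym/eqP.
  rewrite -(dvdn_pcharf char2); apply/negP; rewrite -p'natE //.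
  by case/and3P: sylP.
have uT : T \in unitmx.
  by apply: (mx_Schur irrV) nzT; apply/centgmxP=> x Gx; rewrite eqvT.
have eqvVT : equivariant rV G (invmx T).
  move=> x Gx; apply: (can_inj (mulKmx uT)).
  by rewrite mulKVmx // mulmxA -eqvT // mulmxK.
have nz_vf : v *m f != 0 by rewrite vf1 oner_eq0.
(* Multiplying v by the inverse of T turns the trace into 1, since relative traces commute with
   right multiplication by G-endomorphisms. *)
have [||||[g Gg defQ] trivQ] :=
  vertex_trivial_source (w := v *m invmx T) char2 sPG pP nz_vf _ _ _ _ vxQ.
- by move=> x Px; rewrite fixP ?mulmx1.
- by move=> x Px; rewrite fixP ?mulmx1.
- by move=> x Px; rewrite fixP ?mul1mx.
- by rewrite mulmxA rel_trace_mulr // mulmxV.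
by split; rewrite // defQ (normsP (normal_norm nsPG)).
Qed.

Lemma rel_trace_sylow P : (2%N \in [pchar F])%R -> 2.-Sylow(G) P ->
  rel_trace rV P G 1%:M = 1%:M.
Proof.
move=> char2 sylP; rewrite rel_trace1 ?(pHall_sub sylP) //; congr (_%:M).
apply: (@mulrn_odd _ F^o) => //.
by case/and3P: sylP => _ _; rewrite p'natE // dvdn2 negbK.
Qed.

Lemma sylow_direct_summand P (sPG : P \subset G) : (2%N \in [pchar F])%R ->
  2.-Sylow(G) P -> direct_summand rV (ind_repr G (subg_repr rV sPG)).
Proof.
move=> char2 sylP.
apply: (rel_trace_direct_summand_ind sPG (a := 1%:M) (b := 1%:M)) => [x Px | x Px |].
- by rewrite mulmx1 mul1mx.
- by rewrite mulmx1 mul1mx.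
by rewrite mulmx1 rel_trace_sylow.
Qed.

Lemma mxconj_mul th1 th2 g : g \in G ->
  mxconj rV (th1 *m th2) g = mxconj rV th1 g *m mxconj rV th2 g.
Proof. by move=> Gg; rewrite /mxconj !mulmxA (repr_mxK _ Gg). Qed.

Lemma mxconj_scalar z g : g \in G -> mxconj rV z%:M g = z%:M.
Proof.
move=> Gg; rewrite /mxconj scalar_mxC -mulmxA -repr_mxM ?groupV //.
by rewrite mulVg repr_mx1 mulmx1.
Qed.

Lemma mxconj_is_zmod_morphism g : zmod_morphism (mxconj rV ^~ g).
Proof. by move=> th1 th2; rewrite /mxconj mulmxBr mulmxBl. Qed.

Lemma mxconjK th g : g \in G -> mxconj rV (mxconj rV th g) g^-1%g = th.
Proof.
move=> Gg; rewrite -mxconjM ?groupV // mulgV.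
by rewrite /mxconj invg1 repr_mx1 mul1mx mulmx1.
Qed.

Lemma equivariant_mxconj_norm P R th x : R <| P -> P \subset G -> x \in P ->
  equivariant rV R th -> equivariant rV R (mxconj rV th x).
Proof.
move=> nsRP sPG Px eqv; have sRG := subset_trans (normal_sub nsRP) sPG.
have Gx := subsetP sPG x Px.
apply/(equivariantP rV) => // r Rr; have Gr := subsetP sRG r Rr.
have Rxr : (r ^ x^-1)%g \in R by rewrite memJ_norm // groupV (subsetP (normal_norm nsRP)).
rewrite -mxconjM // conjgCV mxconjM ?(subsetP sRG _ Rxr) //.
by rewrite (mxconj_equivariant sRG eqv Rxr).
Qed.

Lemma equivariant_conj P th g : P \subset G -> g \in G ->
  equivariant rV (P :^ g) th -> equivariant rV P (mxconj rV th g^-1%g).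
Proof.
move=> sPG Gg eqv; apply/(equivariantP rV) => // x Px; have Gx := subsetP sPG x Px.
have Px' : (x ^ g)%g \in P :^ g by rewrite memJ_conjg.
rewrite -mxconjM ?groupV // conjgCV invgK.
rewrite mxconjM ?groupV ?groupJ //; congr (mxconj rV _ _).
by apply: (mxconj_equivariant (H := (P :^ g)%G)) => //; rewrite /= -(conjGid Gg) conjSg.
Qed.

Lemma indecomposable_idempotent : (0 < n)%N ->
    (forall th, equivariant rV G th -> th *m th = th -> th = 0 \/ th = 1%:M) ->
  indecomposable rV.
Proof.
move=> n_gt0 idem; split=> // rU rW [f def_n free_f hom_f].
have full_f : row_full f by apply/eqP; apply: etrans (eqP free_f) def_n.
have /row_fullP[g gf1] := full_f; have [g' fg'] := row_freeP free_f.
have Eg : g = g' by rewrite -[g]mulmx1 -fg' mulmxA gf1 mul1mx.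
have {g' fg' Eg} fg1 : f *m g = 1%:M by rewrite Eg.
(* The projection onto the first summand is transported to an idempotent endomorphism; being 0 or 1
   it forces one of the degrees to vanish, by comparing ranks. *)
pose E : 'M[F]_(rdegree rU + rdegree rW) := block_mx 1%:M 0 0 0.
have EE : E *m E = E.
  by rewrite mulmx_block !mulmx0 !mul0mx mulmx1 !addr0.
have homE x : E *m dadd_grepr rU rW x = dadd_grepr rU rW x *m E.
  by rewrite /= !mulmx_block !mulmx0 !mul0mx !mulmx1 !mul1mx !addr0.
have def_E : E = g *m (f *m E *m g) *m f.
  by rewrite !mulmxA gf1 mul1mx -mulmxA gf1 mulmx1.
case: (idem (f *m E *m g)) => [x Qx||E0|E1].
- have hom_g : rV x *m f = f *m dadd_grepr rU rW x by apply: hom_f.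
  rewrite !mulmxA hom_g -(mulmxA f _ E) -homE -!mulmxA; congr (_ *m (_ *m _)).
  by rewrite -[LHS]mul1mx -gf1 -mulmxA (mulmxA f) -hom_g -mulmxA fg1 mulmx1.
- by rewrite -!mulmxA (mulmxA g) gf1 mul1mx (mulmxA E) EE.
- left; move: def_E; rewrite E0 mulmx0 mul0mx => /(congr1 mxrank).
  by rewrite mxrank0 rank_diag_block_mx mxrank1 mxrank0 addn0.
right; move: def_E; rewrite E1 mulmx1 gf1 => /(congr1 mxrank).
rewrite mxrank1 rank_diag_block_mx mxrank1 mxrank0 addn0 => /eqP.
by rewrite -{1}[rdegree rU]addn0 eqn_add2l => /eqP.
Qed.

End Vertex.

(** * Composition factors as subquotients *)

Section CompositionFactor.

Variables (F : fieldType) (gT : finGroupType) (G : {group gT}).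

(** E is realised as W / U for consecutive terms of the series. The matrix A is defined on the whole
    space, but only its values on W matter: there it is equivariant with kernel U. *)
Lemma composition_factor_quotient d n (rE : mx_representation F G d)
    (rM : mx_representation F G n) :
    composition_factor rE rM ->
  mx_irreducible rE /\
  exists (U W : 'M_n) (A : 'M_(n, d)),
    [/\ mxmodule rM U, mxmodule rM W, ~~ (W <= U)%MS,
        forall m (w : 'M_(m, n)) x, (w <= W)%MS -> x \in G ->
          w *m rM x *m A = w *m A *m rE x
      & forall m (w : 'M_(m, n)), (w <= W)%MS -> (w *m A == 0) = (w <= U)%MS].
Proof.
case=> Vs [compVs [i [_ lt_i sim]]].
split; first exact: mx_rsim_irr sim (mx_series_repr_irr compVs lt_i).
(* Prepending 0 shifts the index by one, so that U is the term just below W, and 0 when i = 0. *)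
pose U := (0 :: Vs)`_i; pose W := Vs`_i.
pose modU : mxmodule rM U := mx_subseries_module' i (proj1 compVs).
pose modW : mxmodule rM W := mx_subseries_module i (proj1 compVs).
pose S := <<in_factmod U W>>%MS.
case: sim => f _ free_f hom_f.
have sub_S m (w : 'M_(m, n)) : (w <= W)%MS -> (in_factmod U w <= S)%MS.
  by move=> sw; rewrite genmxE submxMr.
exists U, W, (in_factmod U 1%:M *m in_submod S 1%:M *m f).
have AE m (w : 'M_(m, n)) : w *m (in_factmod U 1%:M *m in_submod S 1%:M *m f)
    = in_submod S (in_factmod U w) *m f.
  by rewrite [in RHS]in_submodE [in RHS]in_factmodE !mulmxA.
split=> // [|m w x sw Gx|m w sw].
- by have [_ /(_ i lt_i)[/andP[]]] := compVs.
- rewrite !AE -[RHS]mulmxA -hom_f // mulmxA; congr (_ *m f).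
  rewrite (in_factmodJ modU) //; exact: in_submodJ (sub_S m w sw).
rewrite AE; apply/eqP/idP=> [|sU]; last first.
  have /eqP -> : in_factmod U w == 0 by rewrite in_factmod_eq0.
  by rewrite linear0 mul0mx.
rewrite -[0](mul0mx _ f) => /(row_free_inj free_f) S0.
by rewrite -in_factmod_eq0 -(in_submodK (sub_S m w sw)) S0 linear0.
Qed.

Lemma trivial_action_rsim d (rE : mx_representation F G d) :
    mx_irreducible rE -> {in G, forall x, rE x = 1%:M} ->
  mx_rsim rE (trivial_repr F G).
Proof.
move=> irrE triv.
have [d_gt0 fullE] := (iffLR (mx_irrP _) irrE).
pose u : 'rV[F]_d := delta_mx 0 (Ordinal d_gt0).
have modu : mxmodule rE <<u>>%MS.
  by apply/mxmoduleP=> x Gx; rewrite triv // mulmx1.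
have nzu : <<u>>%MS != 0.
  by rewrite -mxrank_eq0 genmxE mxrank_delta.
have := fullE _ modu nzu; rewrite /row_full genmxE => /eqP rku.
have d1 : d = 1%N.
  by apply/eqP; rewrite eqn_leq d_gt0 andbT -rku rank_leq_row.
subst d; exists 1%:M => //; first by rewrite row_free_unit unitmx1.
by move=> x Gx; rewrite triv // mulmx1.
Qed.

End CompositionFactor.

(** * The natural module *)

Section NaturalModule.

Variables (F : fieldType) (n : nat).
Hypothesis char2 : (2%N \in [pchar F])%R.
Implicit Types (x y : 'rV[F]_n) (a b c i j k l : 'I_n).

Local Notation e i := (@delta_mx F 1 n 0 i).
Local Notation natA := (subg_repr (natural_perm_repr n F) (Alt_subset 'I_n)).

Definition sum_zero x := \sum_i x 0 i = 0.

Lemma row_perm_mxE x s i : (x *m perm_mx s) 0 i = x 0 (s^-1%g i).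
Proof. by rewrite -[s in perm_mx s]invgK -col_permE mxE. Qed.

Lemma delta_perm_mx i (s : 'S_n) : e i *m perm_mx s = e (s i).
Proof.
by apply/rowP=> j; rewrite row_perm_mxE !mxE eqxx /= (can2_eq (permKV s) (permK s)).
Qed.

Lemma sum_zeroD x y : sum_zero x -> sum_zero y -> sum_zero (x + y).
Proof.
rewrite /sum_zero => sum0x sum0y; under eq_bigr do rewrite mxE.
by rewrite big_split /= sum0x sum0y addr0.
Qed.

Lemma sum_zeroZ z x : sum_zero x -> sum_zero (z *: x).
Proof.
rewrite /sum_zero => sum0x; under eq_bigr do rewrite mxE.
by rewrite -mulr_sumr sum0x mulr0.
Qed.

Lemma sum_zero_delta2 i j : sum_zero (e i + e j).
Proof.
have sum1 k : \sum_l (e k) 0 l = 1.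
  rewrite (bigD1 k) //= mxE !eqxx big1 ?addr0 // => l /negPf ne_lk.
  by rewrite mxE ne_lk andbF.
rewrite /sum_zero; under eq_bigr do rewrite mxE.
by rewrite big_split /= !sum1 addrr_pchar2.
Qed.

Lemma sum_perm_mx x s : \sum_i (x *m perm_mx s) 0 i = \sum_i x 0 i.
Proof.
rewrite (reindex_inj (@perm_inj _ s)) /=.
by apply: eq_bigr => i _; rewrite row_perm_mxE permK.
Qed.

Lemma sum_zero_perm x s : sum_zero x -> sum_zero (x *m perm_mx s).
Proof. by rewrite /sum_zero sum_perm_mx. Qed.

(** In characteristic 2 a transposition acts as a transvection, with no sign to keep track of. *)
Lemma tperm_mxE x a b :
  x *m perm_mx (tperm a b) = x + (x 0 a + x 0 b) *: (e a + e b).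
Proof.
apply/rowP=> i; rewrite row_perm_mxE tpermV !mxE eqxx /=.
have addxx (z : F) : z + z = 0 by rewrite addrr_pchar2.
have [-> | ne_ab] := eqVneq a b.
  by rewrite tperm1 perm1 addxx mul0r addr0.
case: tpermP => [-> | -> | ne_ia ne_ib].
- by rewrite eqxx (negPf ne_ab) addr0 mulr1 addrA addxx add0r.
- by rewrite eqxx eq_sym (negPf ne_ab) add0r mulr1 addrCA addxx addr0.
by rewrite !(introF eqP _) // addr0 mulr0 addr0.
Qed.

Lemma tperm2_mxE x a b c d : uniq [:: a; b; c; d] ->
  x *m perm_mx (tperm a b * tperm c d)
    = x + (x 0 a + x 0 b) *: (e a + e b) + (x 0 c + x 0 d) *: (e c + e d).
Proof.
rewrite /= !inE !negb_or -!andbA => /and5P[_ ac ad bc /and3P[bd _ _]].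
rewrite perm_mxM mulmxA !tperm_mxE; congr (_ + _ *: _).
rewrite !mxE eqxx /= ![c == _]eq_sym ![d == _]eq_sym.
by rewrite (negPf ac) (negPf ad) (negPf bc) (negPf bd) !addr0 mulr0 !addr0.
Qed.

Lemma alt_tperm2 a b c d : a != b -> c != d -> (tperm a b * tperm c d)%g \in 'Alt_('I_n).
Proof. by move=> ne_ab ne_cd; rewrite Alt_even odd_permM !odd_tperm ne_ab ne_cd. Qed.

Section Submodules.

Variable N : 'M[F]_n.
Hypotheses (n_ge5 : (5 <= n)%N) (modN : mxmodule natA N).

Let ex_new (s : seq 'I_n) : (size s < 5)%N -> exists i, i \notin s.
Proof. by move=> lt_s; apply: exists_notin; rewrite card_ord (leq_trans lt_s). Qed.

Lemma natural_submodJ x s : s \in 'Alt_('I_n) -> (x <= N)%MS -> (x *m perm_mx s <= N)%MS.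
Proof. by move=> As sxN; apply: (mxmodule_trans modN As). Qed.

(** The even permutation (j k)(j l), with l a new point, fixes i and sends j to k; so e_i + e_k is
    reached for every k, and these vectors generate all e_a + e_b. *)
Lemma natural_submod_delta i j : i != j -> ((e i + e j)%R <= N)%MS ->
  forall a b, ((e a + e b)%R <= N)%MS.
Proof.
move=> ne_ij sij.
have step k : ((e i + e k)%R <= N)%MS.
  have [-> | ne_ki] := eqVneq k i; first by rewrite addvv_pchar2 ?sub0mx.
  have [-> // | ne_kj] := eqVneq k j.
  have [l] := ex_new (isT : size [:: i; j; k] < 5)%N.
  rewrite !inE !negb_or => /and3P[ne_li ne_lj ne_lk].
  have Ag : (tperm j k * tperm j l)%g \in 'Alt_('I_n).
    by rewrite alt_tperm2 // eq_sym.
  have := natural_submodJ Ag sij.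
  have Ei : (tperm j k * tperm j l)%g i = i by rewrite permM !tpermD // eq_sym.
  have Ej : (tperm j k * tperm j l)%g j = k by rewrite permM tpermL tpermD // eq_sym.
  by rewrite mulmxDl !delta_perm_mx Ei Ej.
move=> a b; have -> : e a + e b = (e i + e a) + (e i + e b).
  by rewrite addrACA addvv_pchar2 ?add0r.
by rewrite addmx_sub.
Qed.

(** Applying a double transposition (a b)(c d) to x and adding x leaves a combination w of e_a + e_b
    and e_c + e_d with nonzero first coefficient. From w a single e_i + e_j is extracted. *)
Lemma natural_submod_big x a b : (x <= N)%MS -> x 0 a != x 0 b ->
  forall y, sum_zero y -> (y <= N)%MS.
Proof.
move=> sxN ne_x; have ne_ab : a != b by apply: contra ne_x => /eqP->.
have addxx (z : 'rV[F]_n) : z + z = 0 by apply: addvv_pchar2.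
suff sN i j : ((e i + e j)%R <= N)%MS.
  move=> y sum0y; rewrite [y]row_sum_delta.
  have -> : \sum_j y 0 j *: e j = \sum_j y 0 j *: (e j + e a).
    under [RHS]eq_bigr do rewrite scalerDr; rewrite big_split /= -scaler_suml.
    by rewrite (sum0y : \sum_j y 0 j = 0) scale0r addr0.
  by apply: summx_sub => j _; apply: scalemx_sub.
have [c] := ex_new (isT : size [:: a; b] < 5)%N.
rewrite !inE negb_or => /andP[ne_ca ne_cb].
have [d] := ex_new (isT : size [:: a; b; c] < 5)%N.
rewrite !inE !negb_or => /and3P[ne_da ne_db ne_dc].
have [k] := ex_new (isT : size [:: a; b; c; d] < 5)%N.
rewrite !inE !negb_or => /and4P[ne_ka ne_kb ne_kc ne_kd].
have uniq_abcd : uniq [:: a; b; c; d].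
  rewrite /= !inE !negb_or ne_ab (eq_sym a c) ne_ca (eq_sym a d) ne_da.
  by rewrite (eq_sym b c) ne_cb (eq_sym b d) ne_db (eq_sym c d) ne_dc.
pose al := x 0 a + x 0 b; pose be := x 0 c + x 0 d.
pose w := al *: (e a + e b) + be *: (e c + e d).
have swN : (w <= N)%MS.
  have Eg := tperm2_mxE x uniq_abcd.
  have -> : w = x *m perm_mx (tperm a b * tperm c d) + x.
    by rewrite Eg addrC !addrA addxx add0r.
  by rewrite addmx_sub // natural_submodJ // alt_tperm2 // eq_sym.
have nz_al : al != 0 by rewrite addr_eq0 oppr_pchar2.
have [be0 | nz_be] := eqVneq be 0.
  apply: (natural_submod_delta ne_ab).
  by rewrite -(eqmx_scale _ nz_al) // -[_ *: _]addr0 -(scale0r (e c + e d)) -be0.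
(* When the second coefficient [be] is nonzero, a 3-cycle on c, d and the fifth point k fixes a and
   b; adding w to its image cancels the first term and leaves be (e_k + e_d). *)
apply: (natural_submod_delta ne_kd).
have Ah : (tperm c d * tperm d k)%g \in 'Alt_('I_n) by rewrite alt_tperm2 // eq_sym.
have := addmx_sub (natural_submodJ Ah swN) swN.
have Ea : (tperm c d * tperm d k)%g a = a by rewrite permM !tpermD.
have Eb : (tperm c d * tperm d k)%g b = b by rewrite permM !tpermD.
have Ec : (tperm c d * tperm d k)%g c = k by rewrite permM tpermL tpermL.
have Ed : (tperm c d * tperm d k)%g d = c by rewrite permM tpermR tpermD // eq_sym.
rewrite mulmxDl -!scalemxAl !mulmxDl !delta_perm_mx Ea Eb Ec Ed.
by rewrite addrACA addxx add0r -scalerDr -addrA (addrA (e c)) addxx add0r eqmx_scale.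
Qed.

End Submodules.

Lemma sum_zeroP x : reflect (sum_zero x) (x <= kermx (const_mx 1 : 'cV[F]_n))%MS.
Proof.
have E : x *m (const_mx 1 : 'cV[F]_n) = (\sum_i x 0 i)%:M.
  apply/matrixP=> i j; rewrite !ord1 !mxE mulr1n.
  by apply: eq_bigr => k _; rewrite mxE mulr1.
apply: (iffP sub_kermxP); rewrite E /sum_zero.
  by move/matrixP/(_ 0 0); rewrite !mxE mulr1n.
by move=> sum0x; rewrite sum0x raddf0.
Qed.

(* p maps the sum-zero vectors onto the module, killing the constant ones,    *)
(* and q is a linear section of p.                                            *)
Definition natural_model d (rE : mx_representation F 'Alt_('I_n) d)
    (p : 'M_(n, d)) (q : 'M_(d, n)) :=
  [/\ q *m p = 1%:M, forall y : 'rV_d, sum_zero (y *m q),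
      forall x, sum_zero x -> (x *m p = 0 <-> exists z, x = const_mx z)
    & forall x s, sum_zero x -> s \in 'Alt_('I_n) ->
        x *m perm_mx s *m p = x *m p *m rE s].

(** Submodules of the permutation module either consist of constant vectors or contain the sum-zero
    module K. Nontriviality of W / U forces K into W and U into the constants, so W / U is a
    quotient of K. *)
Lemma natural_simple_model d (rE : mx_representation F 'Alt_('I_n) d) :
    (5 <= n)%N -> natural_simple rE ->
  exists p q, natural_model rE p q.
Proof.
move=> n_ge5 [/composition_factor_quotient[irrE [U [W [A [modU modW nUW homA kerA]]]]] ntE].
have ntriv : ~ {in 'Alt_('I_n), forall s, rE s = 1%:M}.
  by move=> triv; apply: ntE; apply: trivial_action_rsim.
have fullE m (V : 'M_(m, n)) : mxmodule natA V -> (V <= W)%MS -> ~~ (V <= U)%MS ->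
    row_full (V *m A).
  move=> modV sVW nVU; have [_ /(_ <<V *m A>>%MS)] := iffLR (mx_irrP rE) irrE.
  rewrite (eqmx_module _ (genmxE _)) -mxrank_eq0 genmxE mxrank_eq0 kerA // nVU.
  rewrite /row_full genmxE => -> //.
  apply/mxmoduleP=> s As; rewrite -homA //; apply: submxMr.
  by apply: (mxmoduleP modV).
(* A submodule V of W outside U maps onto E; if the group acts trivially on V modulo U, then E is
   trivial. *)
have nfix m (V : 'M_(m, n)) : mxmodule natA V -> (V <= W)%MS -> ~~ (V <= U)%MS ->
    (forall s, s \in 'Alt_('I_n) -> V *m perm_mx s *m A = V *m A) -> False.
  move=> modV sVW nVU fixV; apply: ntriv => s As.
  have /row_fullP[B BVA] := fullE _ V modV sVW nVU.
  have E : V *m A *m rE s = V *m A by rewrite -homA //; apply: fixV.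
  by rewrite -[rE s]mul1mx -{1}BVA -[LHS]mulmxA E.
pose K := kermx (const_mx 1 : 'cV[F]_n).
have KP x : sum_zero x -> (x <= K)%MS by move/sum_zeroP.
have modK : mxmodule natA K.
  apply/mxmoduleP=> s As; apply/row_subP=> i; rewrite row_mul.
  apply/sum_zeroP; apply: (@sum_zero_perm (row i K) s).
  exact/sum_zeroP/row_sub.
have constP m (N : 'M[F]_(m, n)) :
    (exists (r : 'I_m) a b, N r a != N r b) \/ (forall (r : 'I_m) a b, N r a = N r b).
  case: (altP (@existsP _ (fun r : 'I_m => [exists a, exists b, N r a != N r b]))).
    by case=> i /existsP[a /existsP[b ne]]; left; exists i, a, b.
  rewrite negb_exists => /forallP all_i; right=> i a b; apply/eqP.
  have := all_i i; rewrite negb_exists => /forallP/(_ a).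
  by rewrite negb_exists => /forallP/(_ b); rewrite negbK.
have big (N : 'M[F]_n) i a b : mxmodule natA N -> N i a != N i b -> (K <= N)%MS.
  move=> modN ne; apply/row_subP=> k.
  apply: (natural_submod_big n_ge5 modN (row_sub i N) (a := a) (b := b)).
    by rewrite !mxE.
  exact/sum_zeroP/row_sub.
have perm_const m (N : 'M[F]_(m, n)) s : (forall (r : 'I_m) a b, N r a = N r b) ->
    N *m perm_mx s = N.
  move=> cN; rewrite -[s]invgK -col_permE; apply/matrixP=> i j; rewrite mxE; exact: cN.
(* Otherwise W consists of constant vectors, which every permutation fixes. *)
have sKW : (K <= W)%MS.
  case: (constP _ W) => [[i [a [b ne]]] | cW]; first exact: big modW ne.
  case: (nfix _ W modW (submx_refl _) nUW) => s As.
  by rewrite perm_const.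
(* A non-constant row would put K into U, and the group acts trivially modulo K because permutations
   preserve the coordinate sum. *)
have cU i a b : U i a = U i b.
  case: (constP _ U) => [[k [a' [b' ne]]] | eqU]; last exact: eqU.
  have sKU := big _ _ _ _ modU ne.
  case: (nfix _ W modW (submx_refl _) nUW) => s As.
  apply/eqP; rewrite -subr_eq0 -mulmxBl kerA; last first.
    by rewrite addmx_sub ?eqmx_opp //; apply: (mxmoduleP modW).
  apply: submx_trans sKU; apply/row_subP=> k'; apply/sum_zeroP.
  rewrite /sum_zero linearB /= row_mul.
  rewrite (eq_bigr (fun i => (row k' W *m perm_mx s) 0 i - (row k' W) 0 i)).
    by rewrite sumrB sum_perm_mx subrr.
  by move=> j _; rewrite !mxE.
have subU x : (x <= U)%MS -> exists z, x = const_mx z.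
  have i0 : 'I_n by apply: (Ordinal (leq_trans _ n_ge5 : (0 < n)%N)).
  case/submxP=> y ->; exists ((y *m U) 0 i0); apply/rowP=> j; rewrite !mxE.
  by apply: eq_bigr => k _; rewrite (cU k j i0).
have nKU : ~~ (K <= U)%MS.
  pose i0 : 'I_n := Ordinal (leq_trans (isT : 0 < 5)%N n_ge5).
  pose i1 : 'I_n := Ordinal (leq_trans (isT : 1 < 5)%N n_ge5).
  pose i2 : 'I_n := Ordinal (leq_trans (isT : 2 < 5)%N n_ge5).
  apply/negP=> sKU; have [|z Ez] := subU (e i0 + e i1).
    exact: submx_trans (KP _ (sum_zero_delta2 _ _)) sKU.
  move/rowP: Ez => Ez; have := Ez i0; have := Ez i2; rewrite !mxE /= => <- /eqP.
  by rewrite !addr0 oner_eq0.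
have fullK := fullE _ K modK sKW nKU.
(* K maps onto E, so a right inverse on coefficients followed by K gives a linear section with
   sum-zero values. *)
exists A, (pinvmx (K *m A) *m K); split.
- rewrite -mulmxA -[pinvmx _]mul1mx mulmxKpV //; exact: submx_full.
- by move=> y; apply/sum_zeroP; rewrite mulmxA submxMl.
- move=> x sum0x; have sxW := submx_trans (KP x sum0x) sKW; split.
    by move/eqP; rewrite kerA //; apply: subU.
  (* A constant sum-zero vector with nonzero image would span a trivial module mapping onto E. *)
  case=> z def_x; apply/eqP; apply: contraT => nz_xA.
  case: (nfix _ x) => // [||s As]; last first.
  - by rewrite perm_const // => i a b; rewrite def_x !mxE.
  - by rewrite -kerA.
  apply/mxmoduleP=> s As /=; rewrite perm_const // => i a b.
  by rewrite def_x !mxE.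
by move=> x s /KP sx As; rewrite -homA // (submx_trans sx).
Qed.

End NaturalModule.

(** * Odd degree *)

Section OddDegree.

Variables (F : fieldType) (n d : nat) (rE : mx_representation F 'Alt_('I_n) d).
Variables (p : 'M[F]_(n, d)) (q : 'M[F]_(d, n)).
Hypotheses (char2 : (2%N \in [pchar F])%R) (n_ge5 : (5 <= n)%N) (n_odd : odd n).
Hypothesis model : natural_model rE p q.
Let qp1 : q *m p = 1%:M. Proof. by case: model. Qed.
Let sum_q (y : 'rV_d) : sum_zero (y *m q). Proof. by case: model. Qed.
Let ker_p (x : 'rV_n) : sum_zero x -> (x *m p = 0 <-> exists z, x = const_mx z).
Proof. by case: model => _ _ + _; apply. Qed.
Let hom_p (x : 'rV_n) s : sum_zero x -> s \in 'Alt_('I_n) ->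
  x *m perm_mx s *m p = x *m p *m rE s.
Proof. by case: model => _ _ _; apply. Qed.

Local Notation e i := (@delta_mx F 1 n 0 i).
Local Notation G := 'Alt_('I_n)%G.

(** A constant vector z has sum n z = z for n odd, so p is injective on sum-zero vectors and q is
    its inverse there. *)
Let pqK x : sum_zero x -> x *m p *m q = x.
Proof.
move=> sum0x; apply/eqP; rewrite -subr_eq0; apply/eqP.
have sum0d : sum_zero (x *m p *m q - x).
  by rewrite -scaleN1r; apply: sum_zeroD => //; apply: sum_zeroZ.
have [|z def_z] := iffLR (ker_p sum0d).
  by rewrite mulmxBl -!mulmxA qp1 mulmx1 subrr.
move: sum0d; rewrite def_z /sum_zero; under eq_bigr do rewrite mxE.
by rewrite sumr_const card_ord (@mulrn_odd _ F^o) // => ->; apply/rowP=> j; rewrite !mxE.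
Qed.

Let q_perm s : s \in G -> q *m perm_mx s = rE s *m q.
Proof.
move=> As; apply/row_matrixP=> i; rewrite !row_mul.
rewrite -[LHS]pqK; last by apply: sum_zero_perm; rewrite rowE; apply: sum_q.
rewrite hom_p //; last by rewrite rowE; apply: sum_q.
by congr (_ *m _); rewrite rowE -[_ *m q *m p]mulmxA qp1 mulmx1 -rowE.
Qed.

(** The functional taking the coordinate at a, followed by the vector e_a + e_b. Conjugation by g
    sends [psi a b] to [psi (g a) (g b)], so traces become sums over tuples of points. *)
Let psi a b : 'M[F]_d := q *m (e a)^T *m ((e a + e b) *m p).

(** Summing e_a + e_b over b gives n e_a plus the all-one vector. As n is odd the first part yields
    q *m p = 1; the second part vanishes because the rows of q have sum zero. *)
Let sum_psi : \sum_a \sum_b psi a b = 1%:M.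
Proof.
rewrite (eq_bigr (fun a => q *m ((e a)^T *m (e a + const_mx 1)) *m p)) => [|a _].
  rewrite -mulmx_suml -mulmx_sumr.
  under eq_bigr do rewrite mulmxDr.
  rewrite big_split /= mulmxDr mulmxDl -[RHS]addr0; congr (_ + _).
    rewrite -[RHS]qp1 -[in RHS](mulmx1 q); congr (_ *m _ *m _).
    rewrite [RHS]scalar_mx_sum_delta.
    by apply: eq_bigr => i _; rewrite trmx_delta mul_delta_mx scale1r.
  rewrite -mulmx_suml mulmxA.
  suff -> : q *m \sum_i (e i)^T = 0 by rewrite !mul0mx.
  apply/row_matrixP=> i; rewrite row_mul row0.
  have := sum_q (delta_mx 0 i); rewrite -rowE => sum0.
  apply/rowP=> j; rewrite !mxE -[RHS]sum0; apply: eq_bigr => k _.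
  rewrite summxE (bigD1 k) //= big1 => [|l /negPf ne_lk];
    rewrite !mxE ?eqxx ?ord1 ?addr0 ?mulr1 //.
  by rewrite eq_sym ne_lk.
rewrite -mulmx_sumr -mulmx_suml !mulmxA; congr (_ *m _); congr (_ *m _).
rewrite big_split /= sumr_const card_ord mulrn_odd //; congr (_ + _).
apply/rowP=> j; rewrite summxE (bigD1 j) //= big1 => [|l /negPf ne_lj];
  rewrite !mxE ?eqxx ?addr0 //.
by rewrite eq_sym ne_lj.
Qed.

Let i1 : 'I_n := Ordinal (leq_trans (isT : 0 < 5)%N n_ge5).
(** The default [i1] is not reached for k > 0. The triple of the last three points has stabiliser
    [Alt_n_minus_3 n]. *)
Let last_point (k : nat) : 'I_n := insubd i1 (n - k)%N.

Let lastE k : (0 < k <= 5)%N -> last_point k = (n - k)%N :> nat.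
Proof.
case/andP=> k_gt0 k_le5; rewrite val_insubd ifT //.
by rewrite ltn_subrL k_gt0 (leq_trans _ n_ge5).
Qed.

Let a1 := last_point 1.
Let a2 := last_point 2.
Let a3 := last_point 3.
Let t0 : 3.-tuple 'I_n := [tuple a1; a2; a3].

Let uniq_t0 : uniq t0.
Proof.
rewrite /= !inE !negb_or -!val_eqE /= !lastE //.
have [m ->] : exists m, n = (m + 5)%N by exists (n - 5)%N; rewrite subnK.
by rewrite -!addnBA // !eqn_add2l.
Qed.

Let stab_t0 : 'C_G[t0 | 'P * 3] = Alt_n_minus_3 n.
Proof.
apply/setP=> s; apply/setIP/setIP=> -[As].
  move/astab1P=> /= fix_t; split=> //; apply/astabP=> i /=.
  have [E1 E2 E3] : [/\ s a1 = a1, s a2 = a2 & s a3 = a3].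
    by have := congr1 val fix_t; case=> *; split.
  rewrite inE => le_i; have : i \in [:: a1; a2; a3].
    rewrite !inE -!val_eqE /= !lastE //; have := ltn_ord i; move: le_i n_ge5.
    move: (val i) => k; lia.
  by rewrite !inE => /or3P[] /eqP->.
move/astabP=> /= fix_s; split=> //; apply/astab1P.
apply: val_inj => /=.
by rewrite !fix_s // inE lastE // leq_sub2l.
Qed.

Let orbit_t0 : orbit ('P * 3)%act G t0 = 3.-dtuple([set: 'I_n]).
Proof.
have tr3 : [transitive^3 G, on [set: 'I_n] | 'P].
  apply: ntransitive_weak (Alt_trans _); rewrite card_ord.
  by rewrite -(leq_add2r 2) -subn2 subnK // (leq_trans _ n_ge5).
apply: (atransP tr3); rewrite inE uniq_t0 /=.
by apply/subsetP=> i; rewrite inE.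
Qed.

(** A pair of distinct points extends to n - 2 triples, an odd number, while [psi a a] is 0 in
    characteristic 2; the sum therefore reduces to [sum_psi]. *)
Let sum_triples :
  \sum_(t in 3.-dtuple([set: 'I_n])) psi (nth i1 t 0) (nth i1 t 1) = 1%:M.
Proof.
pose h (u : 'I_n * ('I_n * 'I_n)) : 3.-tuple 'I_n := [tuple u.1; u.2.1; u.2.2].
rewrite (reindex h) /=; last first.
  exists (fun t => (tnth t ord0, (tnth t (inord 1), tnth t (inord 2))))
      => [[a [b c]] _|t _].
    by rewrite /= !(tnth_nth a) /= !inordK.
  apply: eq_from_tnth => i; rewrite (tnth_nth i1).
  by case: i => [[|[|[|//]]] lti] /=; congr tnth; apply: val_inj; rewrite /= ?inordK.
rewrite -sum_psi.
rewrite (eq_bigl (fun u : 'I_n * ('I_n * 'I_n) =>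
  true && (uniq [:: u.1; u.2.1; u.2.2]))); last first.
  by move=> u; rewrite inE -[RHS]andbT; congr (_ && _); apply/subsetP=> i; rewrite inE.
rewrite -(pair_big_dep xpredT (fun a (bc : 'I_n * 'I_n) => uniq [:: a; bc.1; bc.2])
   (fun a (bc : 'I_n * 'I_n) => psi a bc.1)) /=.
apply: eq_bigr => a _.
rewrite -(pair_big_dep xpredT (fun b c => uniq [:: a; b; c]) (fun b c => psi a b)) /=.
apply: eq_bigr => b _; rewrite sumr_const.
have [<- | ne_ab] := eqVneq a b.
  by rewrite /psi addvv_pchar2 // mul0mx mulmx0 mul0rn.
apply: (mulrn_odd _ char2).
have card_n : (2 + #|[predC [set a; b]]|)%N = n.
  by rewrite -[RHS]card_ord -(cardC [set a; b]) cards2 ne_ab.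
have {card_n} odd_c : odd #|[predC [set a; b]]|.
  by have := n_odd; rewrite -{1}card_n oddD.
rewrite (_ : #|_| = #|[predC [set a; b]]|) //.
apply: eq_card => c; rewrite -[RHS]/(c \notin [set a; b]).
rewrite -[LHS]/[&& a \notin [:: b; c], b \notin [:: c] & true].
by rewrite !inE !negb_or ne_ab andbT !(eq_sym c).
Qed.

Lemma odd_natural_vertex (P Q : {group 'S_n}) :
    2.-Sylow(Alt_n_minus_3 n) P -> is_vertex rE Q ->
  (exists2 g, g \in 'Alt_('I_n) & Q :=: P :^ g) /\ trivial_source rE Q.
Proof.
move=> sylP vxQ.
have sKG : Alt_n_minus_3 n \subset G by apply: subsetIl.
have sPK := pHall_sub sylP.
have sPG := subset_trans sPK sKG.
have fixK s : s \in Alt_n_minus_3 n -> s a1 = a1 /\ s a2 = a2.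
  by case/setIP=> _ /astabP fix_s; split; apply: fix_s; rewrite inE lastE // leq_sub2l.
have AK s : s \in Alt_n_minus_3 n -> s \in G by apply: (subsetP sKG).
pose v : 'rV_d := (e a1 + e a2) *m p; pose f : 'cV_d := q *m (e a1)^T.
have f_act s : s \in G -> rE s^-1%g *m f = q *m (e (s a1))^T.
  move=> As; rewrite /f mulmxA -q_perm ?groupV // -mulmxA; congr (_ *m _).
  by rewrite -[perm_mx _]trmxK -tr_perm_mx trmxK -trmx_mul delta_perm_mx.
have v_act s : s \in G -> v *m rE s = (e (s a1) + e (s a2)) *m p.
  by move=> As; rewrite -hom_p ?mulmxDl ?delta_perm_mx //; apply: sum_zero_delta2.
have sum_e12 := sum_zero_delta2 char2 a1 a2.
apply: (@vertex_trivial_source _ _ _ _ _ P Q v v f char2 sPG (pHall_pgroup sylP)) => //.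
- rewrite /f mulmxA pqK //; apply/eqP=> /matrixP/(_ 0 0)/eqP.
  rewrite mulmxDl !trmx_delta !mul_delta_mx_cond eqxx.
  have -> : (a2 == a1) = false.
    by move: uniq_t0; rewrite /= !inE negb_or eq_sym => /andP[/andP[/negPf]].
  by rewrite !mxE /= addr0 oner_eq0.
- by move=> s /(subsetP sPK) Ks; have [E1 E2] := fixK s Ks; rewrite v_act ?E1 ?E2 ?AK.
- by move=> s /(subsetP sPK) Ks; have [E1 E2] := fixK s Ks; rewrite v_act ?E1 ?E2 ?AK.
- move=> s /(subsetP sPK); rewrite -groupV => Ks; have [E1 _] := fixK _ Ks.
  by rewrite -{1}[s]invgK f_act ?E1 ?AK.
have conjE g : g \in G -> mxconj rE (f *m v) g = psi (g a1) (g a2).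
  by move=> Ag; rewrite /mxconj mulmxA f_act // -mulmxA v_act.
(* The conjugates depend only on the images of [a1] and [a2], so they are constant on the cosets of
   A_(n-3). The odd index of P in it allows summing over these cosets, that is, over the orbit of
   [t0]: all triples, by 3-transitivity. *)
rewrite /rel_trace (coset_sum_const sPK sKG) => [|s g Ks Ag]; last first.
  have [E1 E2] := fixK s Ks.
  by rewrite !conjE ?groupM ?(AK s) // !permM E1 E2.
rewrite -sum_triples -orbit_t0.
rewrite (coset_sum_orbit _ _ _ (fun t : 3.-tuple _ => psi (nth i1 t 0) (nth i1 t 1))).
rewrite stab_t0 (mulrn_odd _ char2).
  by apply: eq_coset_sum => // g Ag; rewrite conjE.
by case/and3P: sylP => _ _; rewrite p'natE // dvdn2 negbK.
Qed.

End OddDegree.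

(** * Even degree *)

Section Pairs.

Variable n : nat.
Hypothesis n_even : ~~ odd n.
Implicit Types i j k l : 'I_n.

(* The pairs are {2k, 2k + 1}. *)
Definition bar i : 'I_n := insubd i (if odd i then i.-1 else i.+1).

Lemma val_bar i : bar i = (if odd i then i.-1 else i.+1) :> nat.
Proof.
rewrite val_insubd ifT //; have lt_in := ltn_ord i; case: ifP => odd_i; first by lia.
rewrite ltn_neqAle lt_in andbT; apply: contraNneq n_even => <-.
by rewrite /= odd_i.
Qed.

Lemma barK : involutive bar.
Proof.
move=> i; apply: val_inj; rewrite /= !val_bar.
case odd_i: (odd i); last by rewrite /= odd_i.
by rewrite ifF; lia.
Qed.

Lemma bar_neq i : bar i != i.
Proof. by rewrite -val_eqE /= val_bar; case: ifP; lia. Qed.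

Lemma odd_bar i : odd (bar i) = ~~ odd i.
Proof. by rewrite val_bar; case: ifP; lia. Qed.

Definition apart i j := j \notin [:: i; bar i].

Lemma apartE i j : apart i j = (i != j) && (bar i != j).
Proof. by rewrite /apart !inE negb_or ![j == _]eq_sym. Qed.

Lemma apartC i j : apart i j = apart j i.
Proof. by rewrite !apartE eq_sym (can2_eq barK barK) (eq_sym i). Qed.

Lemma uniq_apart i j : apart i j -> uniq [:: i; bar i; j; bar j].
Proof.
move=> ap; have := ap; rewrite apartC apartE => /andP[ji bji]; move: ap.
rewrite apartE => /andP[ij bij].
rewrite /= !inE !negb_or (eq_sym i (bar i)) bar_neq ij (eq_sym i) bji bij.
by rewrite (inj_eq (can_inj barK)) ij eq_sym bar_neq.
Qed.

Lemma exists_apart (s : seq 'I_n) : (2 * size s < n)%N ->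
  exists l, all (fun i => apart i l) s.
Proof.
move=> lt_s; have [|l] := @exists_notin 'I_n (s ++ map bar s).
  by rewrite card_ord size_cat size_map addnn -mul2n.
rewrite mem_cat negb_or => /andP[ls lbs]; exists l; apply/allP=> i si.
rewrite apartE; apply/andP; split; first by apply: contraNneq ls => <-.
by apply: contraNneq lbs => <-; apply: map_f.
Qed.

Lemma big_pairs (V : zmodType) (G : 'I_n -> V) :
  \sum_i G i = \sum_(i : 'I_n | odd i) (G i + G (bar i)).
Proof.
rewrite (bigID (fun i : 'I_n => odd i)) big_split /=; congr (_ + _).
rewrite (reindex_inj (can_inj barK)) /=.
by apply: eq_bigl => i; rewrite odd_bar negbK.
Qed.

Definition swap i : 'S_n := tperm i (bar i).

Lemma swap_bar i : swap (bar i) = swap i.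
Proof. by rewrite /swap barK tpermC. Qed.

Lemma swap_apart i j : ~~ apart i j -> swap i = swap j.
Proof. by rewrite apartE negb_and !negbK => /orP[] /eqP <-; rewrite ?swap_bar. Qed.

Lemma swapK i : (swap i * swap i)%g = 1%g.
Proof. by rewrite /swap tperm2. Qed.

Lemma swap_order i : #[swap i]%g = 2.
Proof.
apply: nt_prime_order; rewrite // ?expgS ?expg0 ?mulg1 ?swapK //.
by apply: contraTneq (bar_neq i) => E; rewrite -(tpermL i (bar i)) -/(swap i) E perm1 eqxx.
Qed.

Lemma swap_commute i j : commute (swap i) (swap j).
Proof.
have [ap | /swap_apart-> //] := boolP (apart i j).
exact/tperm_commute/uniq_apart.
Qed.

Definition double_swaps : {set 'S_n} := [set (swap i * swap j)%g | i in 'I_n, j in 'I_n].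

Lemma mem_double_swaps i j : (swap i * swap j)%g \in double_swaps.
Proof. exact: imset2_f. Qed.

(** The even part of the Young subgroup S_2 x ... x S_2; generators with i and j in the same pair
    are trivial. *)
Definition even_swaps := <<double_swaps>>%G.

Lemma even_swaps_alt : even_swaps \subset 'Alt_('I_n).
Proof.
rewrite gen_subG; apply/subsetP=> _ /imset2P[i j _ _ ->].
by rewrite alt_tperm2 // eq_sym bar_neq.
Qed.

Lemma even_swaps_pgroup : 2.-group even_swaps.
Proof.
apply: (@abelem_pgroup _ 2); apply: gen_involutions_abelem => [x y|x].
  case/imset2P=> i j _ _ -> /imset2P[k l _ _ ->].
  by apply: commuteM; apply/commute_sym/commuteM; apply: swap_commute.
case/imset2P=> i j _ _ ->.
by rewrite {2}[(swap i * swap j)%g]swap_commute mulgA -(mulgA (swap i)) swapK mulg1 swapK.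
Qed.

End Pairs.

(** * Endomorphisms commuting with the even products of swaps *)

Section EvenDegree.

Variables (F : fieldType) (n d : nat) (rE : mx_representation F 'Alt_('I_n) d).
Variables (p : 'M[F]_(n, d)) (q : 'M[F]_(d, n)).
Hypotheses (char2 : (2%N \in [pchar F])%R) (n_even : ~~ odd n).
Hypothesis model : natural_model rE p q.
Let qp1 : q *m p = 1%:M. Proof. by case: model. Qed.
Let sum_q (y : 'rV_d) : sum_zero (y *m q). Proof. by case: model. Qed.
Let ker_p (x : 'rV_n) : sum_zero x -> (x *m p = 0 <-> exists z, x = const_mx z).
Proof. by case: model => _ _ + _; apply. Qed.
Let hom_p (x : 'rV_n) s : sum_zero x -> s \in 'Alt_('I_n) ->
  x *m perm_mx s *m p = x *m p *m rE s.
Proof. by case: model => _ _ _; apply. Qed.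
Implicit Types (x y : 'rV[F]_n) (i j k l : 'I_n) (th : 'M[F]_d).

Local Notation e i := (@delta_mx F 1 n 0 i).
Local Notation G := 'Alt_('I_n)%G.
Let barKn := barK n_even.

Definition pair_mx i := e i + e (bar i).
(** A linear form, one for each pair, that vanishes on constant vectors and therefore makes sense on
    E. Swapping the pair of i adds [hat x i *: pair_mx i]. *)
Definition hat x i := x 0 i + x 0 (bar i).

Let addxx (z : F) : z + z = 0. Proof. exact: addrr_pchar2. Qed.

Lemma pair_mxE i k : pair_mx i 0 k = ((k == i) + (k == bar i))%:R.
Proof. by rewrite !mxE eqxx natrD. Qed.

Lemma pair_mx_id i : pair_mx i 0 i = 1.
Proof. by rewrite pair_mxE eqxx eq_sym (negPf (bar_neq n_even i)). Qed.

Lemma pair_mx_apart i k : apart i k -> pair_mx i 0 k = 0.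
Proof. by rewrite apartE pair_mxE ![k == _]eq_sym => /andP[/negPf-> /negPf->]. Qed.

Lemma pair_mx_bar i : pair_mx (bar i) = pair_mx i.
Proof. by rewrite /pair_mx barKn addrC. Qed.

Lemma sum_zero_pair i : sum_zero (pair_mx i).
Proof. exact: sum_zero_delta2. Qed.

Lemma hatD x y i : hat (x + y) i = hat x i + hat y i.
Proof. by rewrite /hat !mxE addrACA. Qed.

Lemma hatZ z x i : hat (z *: x) i = z * hat x i.
Proof. by rewrite /hat !mxE mulrDr. Qed.

Lemma hat_bar x i : hat x (bar i) = hat x i.
Proof. by rewrite /hat barKn addrC. Qed.

Lemma hat_delta i : hat (e i) i = 1.
Proof. by rewrite /hat !mxE !eqxx (negPf (bar_neq n_even i)) addr0. Qed.

Lemma hat_delta_apart i j : apart i j -> hat (e i) j = 0.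
Proof.
rewrite apartE /hat !mxE eqxx /= ![_ == i]eq_sym => /andP[/negPf-> ].
by rewrite (can2_eq barKn barKn) => /negPf->; rewrite addr0.
Qed.

Lemma hat_pair i j : hat (pair_mx i) j = 0.
Proof.
have [ap | nap] := boolP (apart i j).
  by rewrite hatD !hat_delta_apart ?addr0 // apartE barKn andbC -apartE.
move: nap; rewrite apartE negb_and !negbK => /orP[] /eqP <-; rewrite ?hat_bar.
  by rewrite hatD hat_delta -hat_bar hat_delta addxx.
by rewrite hatD hat_delta -hat_bar hat_delta addxx.
Qed.

Lemma swap2_mxE x i j : apart i j ->
  x *m perm_mx (swap i * swap j) = x + hat x i *: pair_mx i + hat x j *: pair_mx j.
Proof. by move=> ap; rewrite tperm2_mxE // uniq_apart. Qed.

Lemma sum_hat x : sum_zero x -> \sum_(i : 'I_n | odd i) hat x i = 0.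
Proof. by rewrite /sum_zero (big_pairs n_even). Qed.

Lemma hat0_sum_pairs x : (forall i, hat x i = 0) ->
  x = \sum_(i : 'I_n | odd i) x 0 i *: pair_mx i.
Proof.
move=> hat0; rewrite [LHS]row_sum_delta (big_pairs n_even); apply: eq_bigr => i _.
have -> : x 0 (bar i) = x 0 i.
  by apply/eqP; rewrite -subr_eq0 oppr_pchar2 // addrC; apply/eqP/hat0.
by rewrite -scalerDr.
Qed.

(** A sum-zero representative of the image under th; another representative differs by a constant
    vector and has the same [hat]. *)
Let lift th x := x *m p *m th *m q.

Let lift_sum th x : sum_zero (lift th x). Proof. exact: sum_q. Qed.

Let lift_p th x : lift th x *m p = x *m p *m th.
Proof. by rewrite /lift -mulmxA qp1 mulmx1. Qed.

Let sum_zero_pairs z1 z2 i j : sum_zero (z1 *: pair_mx i + z2 *: pair_mx j).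
Proof. by apply: sum_zeroD => //; apply: sum_zeroZ; apply: sum_zero_pair. Qed.

(** With b = swap i * swap j, th commutes with b - 1, and b - 1 sends a vector x to hat x i times
    the pair of i plus hat x j times the pair of j. *)
Lemma swap2_equivariant x th i j : apart i j -> sum_zero x ->
    rE (swap i * swap j)%g *m th = th *m rE (swap i * swap j)%g ->
  (hat (lift th x) i *: pair_mx i + hat (lift th x) j *: pair_mx j) *m p
    = (hat x i *: pair_mx i + hat x j *: pair_mx j) *m p *m th.
Proof.
move=> ap sum0x eqv.
have As : (swap i * swap j)%g \in G.
  by apply: (subsetP (even_swaps_alt n_even)); rewrite mem_gen // mem_double_swaps.
apply: (addrI (lift th x *m p)); rewrite -mulmxDl addrA -swap2_mxE //.
rewrite hom_p // lift_p -mulmxA -eqv mulmxA -hom_p // swap2_mxE //.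
by rewrite -addrA !mulmxDl.
Qed.

Lemma pair_mxp_neq0 i : (2 < n)%N -> pair_mx i *m p != 0.
Proof.
move=> n_gt2; apply/eqP=> /(ker_p (sum_zero_pair i))[z /rowP Ez].
have [l /= /andP[ap _]] := exists_apart (s := [:: i]) n_gt2.
have := Ez i; have := Ez l; rewrite pair_mx_id pair_mx_apart // !mxE => <- /eqP.
by rewrite oner_eq0.
Qed.

(** Only constant vectors die in E; the point l outside all three pairs shows that the constant is
    0, and the coordinate at i is then z1. *)
Lemma pair3_mxp_eq0 z1 z2 z3 i j k l :
    (z1 *: pair_mx i + z2 *: pair_mx j + z3 *: pair_mx k) *m p = 0 ->
    apart i j -> apart i k -> apart i l -> apart j l -> apart k l ->
  z1 = 0.
Proof.
move=> eq0 ij ik il jl kl; have [|z /rowP Ez] := iffLR (ker_p _) eq0.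
  by apply: sum_zeroD => //; apply: sum_zeroZ; apply: sum_zero_pair.
have at_pt m : z1 * pair_mx i 0 m + z2 * pair_mx j 0 m + z3 * pair_mx k 0 m = z.
  by have := Ez m; rewrite !mxE.
have := at_pt l; rewrite !pair_mx_apart // !mulr0 !addr0 => z0.
have := at_pt i; rewrite pair_mx_id !(pair_mx_apart (k := i)) 1?apartC //.
by rewrite !mulr0 !addr0 mulr1 -z0.
Qed.

(* Commutation with swap i * swap j is tested on e_i + e_k; comparing two     *)
(* further pairs j and l (there is no fourth pair when n = 6) shows that th   *)
(* maps pair_mx i to a multiple of itself.                                    *)
Lemma even_swaps_local th : (8 <= n)%N -> equivariant rE (even_swaps n) th ->
  exists la, (forall i, pair_mx i *m p *m th = la *: (pair_mx i *m p))
    /\ (th - la%:M) *m (th - la%:M) = 0.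
Proof.
move=> n_ge8 eqvB.
have eqv i j : rE (swap i * swap j)%g *m th = th *m rE (swap i * swap j)%g.
  by apply: eqvB; rewrite mem_gen ?mem_double_swaps.
pose h i k := lift th (e i + e k).
have sum_e i k : sum_zero (e i + e k) by apply: sum_zero_delta2.
(* For every m apart from i and k, testing with swap i * swap m expresses the image of the pair of i
   by the pairs of i and m. Equating the expressions for m = j and m = l kills the coefficient at j;
   the point i, outside the pairs of j and l, serves to rule out constants. *)
have eigen i k j : apart i k -> apart i j -> apart k j ->
    hat (h i k) j = 0 /\ pair_mx i *m p *m th = hat (h i k) i *: (pair_mx i *m p).
  move=> ik ij kj.
  have [|l /= /and4P[il kl jl _]] := @exists_apart n [:: i; k; j].
    exact: leq_trans n_ge8.
  have E m : apart i m -> apart k m ->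
    pair_mx i *m p *m th = (hat (h i k) i *: pair_mx i + hat (h i k) m *: pair_mx m) *m p.
    move=> im km; rewrite (swap2_equivariant im (sum_e i k) (eqv i m)).
    rewrite !hatD hat_delta (hat_delta_apart im) (hat_delta_apart km).
    by rewrite hat_delta_apart 1?apartC // !addr0 scale0r scale1r addr0.
  have hj0 : hat (h i k) j = 0.
    have Ejl : (hat (h i k) j *: pair_mx j + hat (h i k) l *: pair_mx l) *m p = 0.
      have := E j ij kj; rewrite (E l il kl) !mulmxDl => /addrI->.
      by rewrite -mulmxDl addvv_pchar2 // mul0mx.
    by apply: (@pair3_mxp_eq0 _ (hat (h i k) l) 0 j l l i); rewrite ?scale0r ?addr0 // apartC.
  by split; rewrite // (E j ij kj) hj0 scale0r addr0 scalemxAl.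
have third i k : exists j, apart i j /\ apart k j.
  have [|j /= /and3P[ij kj _]] := @exists_apart n [:: i; k]; last by exists j.
  exact: leq_trans n_ge8.
have pair_th i k : apart i k -> pair_mx i *m p *m th = hat (h i k) i *: (pair_mx i *m p).
  by move=> ik; have [j [ij kj]] := third i k; have [] := eigen i k j ik ij kj.
have uniq_la i z1 z2 : z1 *: (pair_mx i *m p) = z2 *: (pair_mx i *m p) -> z1 = z2.
  move/eqP; rewrite -subr_eq0 -scalerBl scaler_eq0 subr_eq0.
  by rewrite (negPf (pair_mxp_neq0 i (leq_trans _ n_ge8))) // orbF => /eqP.
(* Sums over pairs are indexed by the odd member of each pair. *)
pose oddrep i := if odd i then i else bar i.
have odd_oddrep i : odd (oddrep i).
  by rewrite /oddrep; case: ifP => // odd_i; rewrite odd_bar // odd_i.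
have hat_oddrep x i : hat x (oddrep i) = hat x i.
  by rewrite /oddrep; case: ifP => // _; rewrite hat_bar.
have apart_oddrep i (m : 'I_n) : odd m -> m != oddrep i -> apart i m.
  rewrite apartE /oddrep ![_ == m]eq_sym => odd_m; case: ifP => odd_i ->; rewrite ?andbT.
    by apply: contraTneq odd_m => ->; rewrite odd_bar // odd_i.
  by apply: contraTneq odd_m => ->; rewrite odd_i.
have oddrep_apart i k : apart i (oddrep k) = apart i k.
  rewrite /oddrep; case: ifP => // _.
  by rewrite !apartE (inj_eq (can_inj barKn)) -(can2_eq barKn barKn) andbC.
(* The forms [hat] of a sum-zero vector add up to 0, and here only the pairs of i and k contribute;
   this links the eigenvalues at different pairs. *)
have hat_ik i k : apart i k -> hat (h i k) i = hat (h i k) k.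
  move=> ik; have := sum_hat (lift_sum th (e i + e k)); rewrite -/(h i k).
  rewrite (bigD1 (oddrep i)) //= (bigD1 (oddrep k)) /=; last first.
    rewrite odd_oddrep; apply: contraTneq ik => eq_ik.
    by rewrite -oddrep_apart eq_ik oddrep_apart apartE eqxx.
  rewrite big1 => [|m /andP[/andP[odd_m mi] mk]]; last first.
    by have [] := eigen i k m ik (apart_oddrep i m odd_m mi) (apart_oddrep k m odd_m mk).
  rewrite addr0 !hat_oddrep => /eqP; rewrite addr_eq0 oppr_pchar2 // => /eqP->.
  by [].
pose i0 : 'I_n := Ordinal (leq_trans (isT : 0 < 8)%N n_ge8).
have [k0 [ik0 _]] := third i0 i0.
pose la := hat (h i0 k0) i0.
have th_la i : pair_mx i *m p *m th = la *: (pair_mx i *m p).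
  have [ap | ] := boolP (apart i0 i); last first.
    rewrite apartE negb_and !negbK => /orP[] /eqP <-; rewrite ?pair_mx_bar; exact: pair_th.
  rewrite (pair_th i i0) 1?apartC // hat_ik 1?apartC //; congr (_ *: _).
  rewrite [h i i0]/(lift th (e i + e i0)) addrC -/(h i0 i).
  by apply: (uniq_la i0); rewrite -!pair_th.
have hat_h i k : apart i k -> hat (h i k) i = la.
  by move=> ik; apply: (uniq_la i); rewrite -pair_th // th_la.
have hat_hE i k j : apart i k -> hat (h i k) j = la * hat (e i + e k) j.
  move=> ik; rewrite hatD; have ki : apart k i by rewrite apartC.
  have [ij | ] := boolP (apart i j); last first.
    rewrite apartE negb_and !negbK => /orP[] /eqP <-; rewrite ?hat_bar hat_delta;
    by rewrite hat_delta_apart // addr0 mulr1 hat_h.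
  have [kj | ] := boolP (apart k j); last first.
    rewrite apartE negb_and !negbK => /orP[] /eqP <-; rewrite ?hat_bar hat_delta;
    by rewrite hat_delta_apart // add0r mulr1 -hat_ik // hat_h.
  have [-> _] := eigen i k j ik ij kj.
  by rewrite !hat_delta_apart // addr0 mulr0.
exists la; split=> //; set N := th - _.
have pairN i : pair_mx i *m p *m N = 0.
  by rewrite mulmxBr th_la mul_mx_scalar subrr.
(* N maps e_i + e_k to a vector on which all forms [hat] vanish, hence to a combination of pair
   vectors, and N kills those. *)
have N0 i k : (e i + e k) *m p *m (N *m N) = 0.
  rewrite mulmxA; have [ik | ] := boolP (apart i k); last first.
    rewrite apartE negb_and !negbK => /orP[] /eqP <-.
      by rewrite addvv_pchar2 // !mul0mx.
    by rewrite -/(pair_mx i) pairN mul0mx.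
  pose y := h i k + la *: (e i + e k).
  have -> : (e i + e k) *m p *m N = y *m p.
    rewrite /y /h [RHS]mulmxDl lift_p mulmxBr mul_mx_scalar -scalemxAl.
    by rewrite -[- _]scaleN1r oppr_pchar2 // scale1r.
  rewrite [y]hat0_sum_pairs => [|j]; last by rewrite hatD hatZ hat_hE // addxx.
  rewrite mulmx_suml mulmx_suml big1 // => j _.
  by rewrite -!scalemxAl pairN scaler0.
have xN x : sum_zero x -> x *m p *m (N *m N) = 0.
  move=> sum0x; have -> : x = \sum_j x 0 j *: (e j + e i0).
    under eq_bigr do rewrite scalerDr; rewrite big_split /= -scaler_suml.
    by rewrite (sum0x : \sum_j x 0 j = 0) scale0r addr0 -row_sum_delta.
  by rewrite mulmx_suml mulmx_suml big1 // => j _; rewrite -!scalemxAl N0 scaler0.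
apply/row_matrixP=> r; rewrite row0 rowE -[delta_mx 0 r]mulmx1 -qp1.
by rewrite (mulmxA _ q p) xN.
Qed.

End EvenDegree.

(** * Vertex and source for even n >= 8 *)

Section EvenVertex.

Variables (F : fieldType) (n d : nat) (rE : mx_representation F 'Alt_('I_n) d).
Variables (p : 'M[F]_(n, d)) (q : 'M[F]_(d, n)).
Hypotheses (char2 : (2%N \in [pchar F])%R) (n_even : ~~ odd n) (n_ge8 : (8 <= n)%N).
Hypothesis model : natural_model rE p q.
Let qp1 : q *m p = 1%:M. Proof. by case: model. Qed.
Let sum_q (y : 'rV_d) : sum_zero (y *m q). Proof. by case: model. Qed.
Let ker_p (x : 'rV_n) : sum_zero x -> (x *m p = 0 <-> exists z, x = const_mx z).
Proof. by case: model => _ _ + _; apply. Qed.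
Let hom_p (x : 'rV_n) s : sum_zero x -> s \in 'Alt_('I_n) ->
  x *m perm_mx s *m p = x *m p *m rE s.
Proof. by case: model => _ _ _; apply. Qed.
Implicit Types (th : 'M[F]_d).

Local Notation G := 'Alt_('I_n)%G.
Local Notation B := (even_swaps n).
Let sBG : B \subset G := even_swaps_alt n_even.
Let pair_p i := pair_mx F i *m p.

Let local th : equivariant rE B th ->
  exists la, (forall i, pair_p i *m th = la *: pair_p i)
    /\ (th - la%:M) *m (th - la%:M) = 0.
Proof. exact: even_swaps_local char2 n_even model th n_ge8. Qed.

Let pair_p_neq0 i : pair_p i != 0.
Proof. exact: pair_mxp_neq0 char2 n_even model i (leq_trans _ n_ge8). Qed.

Let i0 : 'I_n := Ordinal (leq_trans (isT : 0 < 8)%N n_ge8).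

(* As th - la is nilpotent, conjugation does not change the eigenvalue la. *)
Let eigen_conj th x : x \in G -> equivariant rE B th ->
    equivariant rE B (mxconj rE th x) ->
  pair_p i0 *m (th + mxconj rE th x) = 0.
Proof.
move=> Gx /local[la [th_la nil_la]] /local[mu [thx_mu _]].
have nil_x : (mxconj rE th x - la%:M) *m (mxconj rE th x - la%:M) = 0.
  rewrite -(mxconj_scalar rE la Gx) -!mxconj_is_zmod_morphism -mxconj_mul //.
  by rewrite nil_la /mxconj mulmx0 mul0mx.
have E : pair_p i0 *m (mxconj rE th x - la%:M) = (mu - la) *: pair_p i0.
  by rewrite mulmxBr thx_mu mul_mx_scalar scalerBl.
have := congr1 (mulmx (pair_p i0)) nil_x; rewrite mulmx0 mulmxA E -scalemxAl E scalerA.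
move/eqP; rewrite scaler_eq0 (negPf (pair_p_neq0 i0)) orbF mulf_eq0 orbb subr_eq0.
by move/eqP=> eq_mu; rewrite mulmxDr th_la thx_mu eq_mu addvv_pchar2.
Qed.

(* On the fixed vector pair_p k of b = swap i * swap j, th + th^b takes a     *)
(* value in the image of b - 1, which is spanned by pair_p i and pair_p j.    *)
Let trace_swap2 i j th : apart i j ->
    equivariant rE B (th + mxconj rE th (swap i * swap j)%g) ->
  pair_p i0 *m (th + mxconj rE th (swap i * swap j)%g) = 0.
Proof.
move=> ij /local[la [u_la _]].
have Gb : (swap i * swap j)%g \in G.
  by apply: (subsetP sBG); rewrite mem_gen ?mem_double_swaps.
have [|k /= /and3P[ik jk _]] := @exists_apart n [:: i; j].
  exact: leq_trans n_ge8.
have [|l /= /and4P[il jl kl _]] := @exists_apart n [:: i; j; k].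
  exact: leq_trans n_ge8.
have sum0s := sum_zero_pair char2.
pose w := pair_p k *m th *m q.
have sum0w : sum_zero w by apply: sum_q.
have wp : w *m p = pair_p k *m th by rewrite /w -mulmxA qp1 mulmx1.
have fix_k : pair_p k *m rE (swap i * swap j)%g = pair_p k.
  rewrite -hom_p //; congr (_ *m p).
  by rewrite swap2_mxE // !hat_pair // !scale0r !addr0.
have fix_kV : pair_p k *m rE (swap i * swap j)^-1%g = pair_p k.
  by rewrite -{1}fix_k repr_mxK.
have la0 : la = 0.
  have := u_la k; rewrite mulmxDr /mxconj !mulmxA fix_kV -wp -hom_p //.
  rewrite swap2_mxE // !mulmxDl !addrA addvv_pchar2 // add0r => E.
  apply: (pair3_mxp_eq0 char2 n_even model (i := k) (j := i) (k := j) (l := l)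
    (z2 := hat w i) (z3 := hat w j)) => //; try by rewrite apartC.
  by rewrite !mulmxDl -addrA E -scalemxAl addvv_pchar2.
  by rewrite u_la la0 scale0r.
Qed.

Lemma even_natural_vertex (Q : {group 'S_n}) (sQG : Q \subset G) :
    is_vertex rE Q -> 2.-Sylow(G) Q /\ is_source rE (subg_repr rE sQG).
Proof.
move=> vxQ; have [P sylP sBP] := Sylow_superset sBG (even_swaps_pgroup n_even).
have pP := pHall_pgroup sylP; have sPG := pHall_sub sylP.
have [k nz_k] : exists k, pair_p i0 0 k != 0.
  by apply/rV0Pn.
pose f : 'cV[F]_d := delta_mx k 0.
have nz_f : pair_p i0 *m f != 0.
  by apply: contraNneq nz_k => /matrixP/(_ 0 0); rewrite -colE !mxE => ->.
have key (R : {group 'S_n}) x th : maximal R P -> x \in P -> x \notin R -> equivariant rE R th ->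
    pair_p i0 *m (th + mxconj rE th x) *m f = 0.
  move=> maxR Px notRx eqR; have nsRP := p_maximal_normal pP maxR.
  have sRP := normal_sub nsRP; have sRG := subset_trans sRP sPG.
  have iRP := p_maximal_index pP maxR.
  suff -> : pair_p i0 *m (th + mxconj rE th x) = 0 by rewrite mul0mx.
  (* If R contains B, then th and th^x both commute with B. Otherwise some generator b of B lies
     outside R and can replace x as the representative of the nontrivial coset. *)
  have [sBR | nsBR] := boolP (B \subset R).
    apply: eigen_conj; rewrite ?(subsetP sPG) //; first exact: equivariantS eqR.
    by apply: equivariantS sBR _; apply: (equivariant_mxconj_norm nsRP sPG Px).
  have [b Sb notRb] : exists2 b, b \in double_swaps n & b \notin R.
    by apply/subsetPn; rewrite -gen_subG.
  case/imset2P: Sb notRb => i j _ _ -> notRb.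
  have Pb : (swap i * swap j)%g \in P.
    by apply: (subsetP sBP); rewrite mem_gen ?mem_double_swaps.
  have ij : apart i j.
    apply: contraR notRb => /(swap_apart n_even)->.
    by rewrite swapK group1.
  rewrite -(rel_trace_index2 sRP sPG iRP Px notRx eqR).
  rewrite (rel_trace_index2 sRP sPG iRP Pb notRb eqR).
  apply: trace_swap2 ij _; apply: equivariantS sBP _.
  rewrite -(rel_trace_index2 sRP sPG iRP Pb notRb eqR).
  exact: equivariant_rel_trace.
have homP : {in P, forall h, rE h *m 1%:M = 1%:M *m subg_repr rE sPG h}.
  by move=> h _; rewrite mulmx1 mul1mx.
have homP' : {in P, forall h, subg_repr rE sPG h *m 1%:M = 1%:M *m rE h}.
  by move=> h _; rewrite mulmx1 mul1mx.
have tr1 : rel_trace rE P G (1%:M *m 1%:M) = 1%:M by rewrite mulmx1 rel_trace_sylow.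
have [g Gg defQ] := vertex_conj sPG homP homP' tr1 pP nz_f key vxQ.
have sylQ : 2.-Sylow(G) Q by rewrite defQ pHallJ.
split=> //; split; last exact: sylow_direct_summand.
(* An idempotent commuting with Q is conjugated to one commuting with B; its eigenvalue on the pair
   vectors is 0 or 1, and square-zero nilpotency makes it 0 or the identity. *)
apply: indecomposable_idempotent => [|th eqQ idem_th]; first exact: leq_ltn_trans (ltn_ord k).
pose th' := mxconj rE th g^-1%g.
have eqB : equivariant rE B th'.
  apply: equivariantS sBP _; apply: (equivariant_conj sPG Gg).
  by move=> x; rewrite -defQ; apply: eqQ.
have idem_th' : th' *m th' = th' by rewrite -mxconj_mul ?groupV // idem_th.
have th_th' : th = mxconj rE th' g by rewrite -{1}[g]invgK mxconjK ?groupV.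
have [la [th_la nil_la]] := local eqB.
have : la * la = la.
  have := congr1 (mulmx (pair_p i0)) idem_th'.
  rewrite mulmxA !th_la -scalemxAl th_la scalerA => /eqP.
  by rewrite -subr_eq0 -scalerBl scaler_eq0 (negPf (pair_p_neq0 i0)) orbF subr_eq0 => /eqP.
have [la0 _ | nz_la] := eqVneq la 0.
  left; move: nil_la; rewrite la0 raddf0 subr0 idem_th' => th'0.
  by rewrite th_th' th'0 /mxconj mulmx0 mul0mx.
rewrite -{3}[la]mulr1 => /(mulfI nz_la) la1; right.
move: nil_la; rewrite la1 mulmxBl mulmxBr idem_th' mul1mx mulmx1 subrr sub0r => /eqP.
rewrite oppr_eq0 subr_eq0 => /eqP th'1.
by rewrite th_th' th'1 mxconj_scalar.
Qed.

End EvenVertex.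

(** * Degree 6 *)

Section Points.

Definition pt (k : nat) : 'I_6 := inord k.

Lemma ptE k : (k < 6)%N -> pt k = k :> nat.
Proof. exact: inordK. Qed.

Lemma pt_ind (A : 'I_6 -> Prop) :
  A (pt 0) -> A (pt 1) -> A (pt 2) -> A (pt 3) -> A (pt 4) -> A (pt 5) -> forall i, A i.
Proof.
move=> ? ? ? ? ? ? i; have -> : i = pt i by apply: val_inj; rewrite /= ptE.
by case: i => [[|[|[|[|[|[|//]]]]]] ?] /=.
Qed.

Lemma pt_eq k l : (k < 6)%N -> (l < 6)%N -> (pt k == pt l) = (k == l).
Proof. by move=> k6 l6; rewrite -val_eqE /= !ptE. Qed.

Lemma bar_pt k : (k < 6)%N -> bar (pt k) = pt (if odd k then k.-1 else k.+1).
Proof.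
move=> k6; apply: val_inj; rewrite /= val_bar // ptE // ptE //.
by move: k6; do 6!case: k => [|k] //.
Qed.

Definition t12 : 'S_6 := swap (pt 0) * swap (pt 2).
Definition t23 : 'S_6 := swap (pt 2) * swap (pt 4).
Definition t13 : 'S_6 := swap (pt 0) * swap (pt 4).

Lemma swapE k : (k < 6)%N ->
  swap (pt k) = tperm (pt k) (pt (if odd k then k.-1 else k.+1)).
Proof. by move=> k6; rewrite /swap bar_pt. Qed.

Local Notation Y := (Young_222 6).
Local Notation P := (Y :&: 'Alt_('I_6))%G.

Lemma young_swap k : k \in [:: 0; 2; 4]%N -> swap (pt k) \in Y.
Proof.
move=> k024; rewrite swapE; last by move: k024; do 5!case: k => [|k] //.
apply: mem_gen; apply/imset2P; exists (pt k) (pt (if odd k then k.-1 else k.+1)) => //.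
rewrite inE; move: k024; rewrite !inE => /or3P[] /eqP-> /=; by rewrite !ptE.
Qed.

Lemma young_cases s : s \in Y -> exists x y z : bool,
  s = ((if x then swap (pt 0) else 1) * (if y then swap (pt 2) else 1)
        * (if z then swap (pt 4) else 1))%g.
Proof.
pose C (k : nat) : {group 'S_6} := <[swap (pt k)]>%G.
have com k l : C k \subset 'C(C l) by apply/cents_cycle/swap_commute.
have cyc k s' : (k < 6)%N -> s' \in C k -> exists x : bool, s' = if x then swap (pt k) else 1%g.
  move=> k6; rewrite /C /= cycle2g ?swap_order //.
  by case/set2P=> def_s; [exists false | exists true]; rewrite def_s.
have sY : Y \subset (C 0%N <*> C 2%N) <*> C 4%N.
  rewrite gen_subG; apply/subsetP=> s' /imset2P[i j _]; rewrite inE => ij ->.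
  have /or3P[] : [|| tperm i j == swap (pt 0), tperm i j == swap (pt 2) | tperm i j == swap (pt 4)].
    move: ij; rewrite !swapE // !inE !xpair_eqE.
    have E (a : 'I_6) (k : nat) : val a == k -> (k < 6)%N -> a = pt k.
      by move=> /eqP Ea k6; apply: val_inj; rewrite /= ptE.
    case/or3P=> /andP[/E Ei /E Ej]; by rewrite Ei // Ej // eqxx ?orbT.
  - by move/eqP->; do 2!apply: (subsetP (joing_subl _ _)); apply: cycle_id.
  - move/eqP->; apply: (subsetP (joing_subl _ _)); apply: (subsetP (joing_subr _ _)).
    exact: cycle_id.
  by move/eqP->; apply: (subsetP (joing_subr _ _)); apply: cycle_id.
have sub4 : (C 0%N <*> C 2%N)%G \subset 'C(C 4%N) by rewrite join_subG !com.
move/(subsetP sY); rewrite (cent_joinEl sub4).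
rewrite /= (cent_joinEl (com 0%N 2%N)).
case/mulsgP=> _ z /mulsgP[x y Cx Cy ->] Cz ->.
have [[x' ->] [[y' ->] [z' ->]]] := (cyc 0%N x isT Cx, (cyc 2%N y isT Cy, cyc 4%N z isT Cz)).
by exists x', y', z'.
Qed.

Lemma even_young_cases s : (s \in P) = (s \in [:: 1; t12; t23; t13]%g).
Proof.
have odd_swap k : odd_perm (swap (pt k)) by rewrite odd_tperm eq_sym bar_neq.
apply/idP/idP=> [/setIP[/young_cases[x [y [z ->]]]] | ].
  rewrite Alt_even !odd_permM.
  case: x; case: y; case: z; rewrite ?odd_swap ?odd_perm1 //= => _;
    by rewrite !inE ?mulg1 ?mul1g /t12 /t13 /t23 eqxx ?orbT.
have in_P k l : k \in [:: 0; 2; 4]%N -> l \in [:: 0; 2; 4]%N -> (swap (pt k) * swap (pt l))%g \in P.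
  move=> k024 l024; rewrite inE groupM ?young_swap //=.
  by rewrite Alt_even odd_permM !odd_swap.
rewrite 3!in_cons mem_seq1 => /or4P[] /eqP->; [exact: group1 | exact: in_P ..].
Qed.

Lemma even_young_uniq : uniq [:: 1; t12; t23; t13]%g.
Proof.
have neq (s t : 'S_6) k : s (pt k) != t (pt k) -> s != t by apply: contra => /eqP->.
rewrite /= !inE !negb_or /t12 /t23 /t13 !swapE //= -!andbA andbT.
apply/and5P; split; last (apply/andP; split).
all: rewrite ?[1%g == _]eq_sym.
- by apply: (neq _ _ 0%N); rewrite !permE /= !permE /= !pt_eq.
- by apply: (neq _ _ 2%N); rewrite !permE /= !permE /= !pt_eq.
- by apply: (neq _ _ 0%N); rewrite !permE /= !permE /= !pt_eq.
- by apply: (neq _ _ 0%N); rewrite !permE /= !permE /= !pt_eq.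
- by apply: (neq _ _ 2%N); rewrite !permE /= !permE /= !pt_eq.
by apply: (neq _ _ 0%N); rewrite !permE /= !permE /= !pt_eq.
Qed.

Lemma card_even_young : #|P| = 4.
Proof. by rewrite (eq_card even_young_cases); apply: card_uniqP even_young_uniq. Qed.

Lemma even_young_pgroup : 2.-group P.
Proof. by rewrite /pgroup /= card_even_young. Qed.

End Points.

Section DegreeSix.

Variables (F : fieldType) (d : nat) (rE : mx_representation F 'Alt_('I_6) d).
Variables (p : 'M[F]_(6, d)) (q : 'M[F]_(d, 6)) (w : F).
Hypotheses (char2 : (2%N \in [pchar F])%R) (w2 : w * w = w + 1).
Hypothesis model : natural_model rE p q.
Let qp1 : q *m p = 1%:M. Proof. by case: model. Qed.
Let sum_q (y : 'rV_d) : sum_zero (y *m q). Proof. by case: model. Qed.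
Let ker_p (x : 'rV_6) : sum_zero x -> (x *m p = 0 <-> exists z, x = const_mx z).
Proof. by case: model => _ _ + _; apply. Qed.
Let hom_p (x : 'rV_6) s : sum_zero x -> s \in 'Alt_('I_6) ->
  x *m perm_mx s *m p = x *m p *m rE s.
Proof. by case: model => _ _ _; apply. Qed.
Implicit Types (x y : 'rV[F]_6).

Local Notation G := 'Alt_('I_6)%G.
Local Notation P := (Young_222 6 :&: 'Alt_('I_6))%G.
Local Notation e k := (@delta_mx F 1 6 0 (pt k)).
Local Notation s k := (pair_mx F (pt k)).

Let n_even : ~~ odd 6 := isT.
Let two0 : 2%:R = 0 :> F. Proof. exact: pcharf0. Qed.

Let natr_mod2 m : m%:R = (odd m)%:R :> F.
Proof. by rewrite -[in LHS](odd_double_half m) natrD -mul2n natrM two0 mul0r addr0. Qed.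

(** These equations let [ring] reduce numerals up to 8 modulo 2 in the coordinate computations. *)
Let three1 : 3%:R = 1 :> F. Proof. exact: natr_mod2. Qed.
Let four0 : 4%:R = 0 :> F. Proof. exact: natr_mod2. Qed.
Let five1 : 5%:R = 1 :> F. Proof. exact: natr_mod2. Qed.
Let six0 : 6%:R = 0 :> F. Proof. exact: natr_mod2. Qed.
Let seven1 : 7%:R = 1 :> F. Proof. exact: natr_mod2. Qed.
Let eight0 : 8%:R = 0 :> F. Proof. exact: natr_mod2. Qed.

Local Ltac ring4 := ring: w2 two0 three1 four0 five1 six0 seven1 eight0.

Let coordE := (mxE, pt_eq, eqxx, bar_pt).

Let six_coordP x y : x 0 (pt 0) = y 0 (pt 0) -> x 0 (pt 1) = y 0 (pt 1) ->
  x 0 (pt 2) = y 0 (pt 2) -> x 0 (pt 3) = y 0 (pt 3) ->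
  x 0 (pt 4) = y 0 (pt 4) -> x 0 (pt 5) = y 0 (pt 5) -> x = y.
Proof. by move=> *; apply/rowP; apply: pt_ind. Qed.

Let sum6 x : sum_zero x ->
  x 0 (pt 5) = x 0 (pt 0) + x 0 (pt 1) + x 0 (pt 2) + x 0 (pt 3) + x 0 (pt 4).
Proof.
rewrite /sum_zero (eq_bigr (fun i : 'I_6 => x 0 (pt i))) => [|i _]; last first.
  by have -> : pt i = i by apply: val_inj; rewrite /= ptE.
rewrite -(big_mkord xpredT (fun k => x 0 (pt k))) !big_nat_recr //= big_geq // => sum0.
rewrite -[LHS]addr0 -sum0; ring4.
Qed.

Let eq_p x y z : sum_zero x -> sum_zero y -> x = y + const_mx z -> x *m p = y *m p.
Proof.
move=> sum0x sum0y def_x; have Ez : const_mx z = x - y by rewrite def_x addrC addKr.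
have sum0z : sum_zero (const_mx z : 'rV[F]_6).
  by rewrite Ez -scaleN1r; apply: sum_zeroD => //; apply: sum_zeroZ.
have z0 : (const_mx z : 'rV[F]_6) *m p = 0 by apply/(ker_p sum0z); exists z.
by rewrite def_x mulmxDl z0 addr0.
Qed.

Let qK x : sum_zero x -> exists z, x *m p *m q = x + const_mx z.
Proof.
move=> sum0x; have sum0d : sum_zero (x *m p *m q - x).
  by rewrite -scaleN1r; apply: sum_zeroD => //; apply: sum_zeroZ.
have [|z def_z] := iffLR (ker_p sum0d).
  by rewrite mulmxBl -!mulmxA qp1 mulmx1 subrr.
by exists z; rewrite -def_z addrC subrK.
Qed.

(* w is a primitive cube root of unity, and w + 1 = w ^+ 2. The vectors       *)
(* b1 = (e 0 + e 4) + w *: (e 2 + e 4) and b0 = s 0 + w *: s 2 span a summand *)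
(* of the restriction to P; phi1 and phi0 are the coordinates along them.     *)
Definition phi1 x := (w + 1) * (x 0 (pt 0) + x 0 (pt 1)) + (x 0 (pt 2) + x 0 (pt 3)).
Definition phi0 x := (w + 1) * x 0 (pt 0) + x 0 (pt 2) + w * x 0 (pt 4)
  + (x 0 (pt 0) + x 0 (pt 1)) + (w + 1) * (x 0 (pt 2) + x 0 (pt 3)).

Let b1 : 'rV[F]_6 := (e 0 + e 4) + w *: (e 2 + e 4).
Let b0 : 'rV[F]_6 := s 0 + w *: s 2.

Let F1 : 'cV[F]_6 := (w + 1) *: ((e 0)^T + (e 1)^T) + ((e 2)^T + (e 3)^T).
Let F0 : 'cV[F]_6 := (w + 1) *: (e 0)^T + (e 2)^T + w *: (e 4)^T
  + ((e 0)^T + (e 1)^T) + (w + 1) *: ((e 2)^T + (e 3)^T).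

Let mul_deltaT x k : x *m (e k)^T = (x 0 (pt k))%:M.
Proof. by rewrite trmx_delta -colE; apply/matrixP=> i j; rewrite !ord1 !mxE mulr1n. Qed.

Let F1E x : x *m F1 = (phi1 x)%:M.
Proof.
rewrite /F1 /phi1 !mulmxDr -scalemxAr !mulmxDr !mul_deltaT.
by rewrite -!raddfD /= !scale_scalar_mx -raddfD.
Qed.

Let F0E x : x *m F0 = (phi0 x)%:M.
Proof.
rewrite /F0 /phi0 !mulmxDr -!scalemxAr !mulmxDr !mul_deltaT.
by rewrite -!raddfD /= !scale_scalar_mx -!raddfD.
Qed.

Let f1 : 'cV[F]_d := q *m F1.
Let f0 : 'cV[F]_d := q *m F0.

Let f1E x : sum_zero x -> x *m p *m f1 = (phi1 x)%:M.
Proof.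
move=> sum0x; have [z Ez] := qK sum0x; rewrite /f1 mulmxA Ez F1E.
by congr (_%:M); rewrite /phi1 !mxE; ring4.
Qed.

Let f0E x : sum_zero x -> x *m p *m f0 = (phi0 x)%:M.
Proof.
move=> sum0x; have [z Ez] := qK sum0x; rewrite /f0 mulmxA Ez F0E.
by congr (_%:M); rewrite /phi0 !mxE; ring4.
Qed.

Let eq_mulp m (A1 A2 : 'M[F]_(d, m)) :
  (forall x, sum_zero x -> x *m p *m A1 = x *m p *m A2) -> A1 = A2.
Proof.
move=> eqA; apply/row_matrixP=> i; rewrite !rowE -[delta_mx 0 i]mulmx1 -qp1.
by rewrite (mulmxA _ q p) eqA.
Qed.

Let sum_b1 : sum_zero b1.
Proof. by apply: sum_zeroD; [|apply: sum_zeroZ]; apply: sum_zero_delta2. Qed.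

Let sum_b0 : sum_zero b0.
Proof. by apply: sum_zeroD; [|apply: sum_zeroZ]; apply: sum_zero_delta2. Qed.

Let eB1 : 'rV[F]_d := b1 *m p.
Let eB0 : 'rV[F]_d := b0 *m p.

(** h acts on the span of b1 and b0 by the unipotent matrix [T c] defined below, and compatibly on
    the coordinate functionals. *)
Let acts_by (c : F) h := [/\ eB1 *m rE h = eB1 + c *: eB0, eB0 *m rE h = eB0,
  rE h *m f1 = f1 & rE h *m f0 = f0 + c *: f1].

(** The equation for b1 need only hold up to a constant vector z, which p kills. *)
Let swap2_acts k l c z : apart (pt k) (pt l) -> (swap (pt k) * swap (pt l))%g \in G ->
    b1 *m perm_mx (swap (pt k) * swap (pt l)) = b1 + c *: b0 + const_mx z ->
    (forall x, phi1 (x *m perm_mx (swap (pt k) * swap (pt l))) = phi1 x) ->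
    (forall x, sum_zero x ->
      phi0 (x *m perm_mx (swap (pt k) * swap (pt l))) = phi0 x + c * phi1 x) ->
  acts_by c (swap (pt k) * swap (pt l))%g.
Proof.
move=> kl Gh Eb1 E1 E0; have sum0h := sum_zero_perm.
split.
- rewrite -hom_p // (@eq_p _ (b1 + c *: b0) z) //; first by rewrite mulmxDl -scalemxAl.
    exact: sum0h.
  by apply: sum_zeroD => //; apply: sum_zeroZ.
- rewrite -hom_p //; congr (_ *m p).
  have hat_b0 i : hat b0 i = 0 by rewrite hatD hatZ !hat_pair // mulr0 addr0.
  by rewrite swap2_mxE // !hat_b0 !scale0r !addr0.
- by apply: eq_mulp => x sum0x; rewrite mulmxA -hom_p // !f1E ?E1 //; apply: sum0h.
apply: eq_mulp => x sum0x; rewrite mulmxA -hom_p // f0E ?E0 //; last exact: sum0h.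
by rewrite mulmxDr -scalemxAr f0E // f1E // scale_scalar_mx raddfD.
Qed.

Let t12_acts : acts_by 1 t12.
Proof.
have ap : apart (pt 0) (pt 2) by rewrite apartE // !coordE.
apply: (@swap2_acts 0 2 1 0) => // [||x|x sum0x]; rewrite ?swap2_mxE //.
- by have /setIP[] : t12 \in P by rewrite even_young_cases !inE eqxx ?orbT.
- by apply: six_coordP; rewrite /b1 /b0 /pair_mx /hat !coordE //=; ring4.
- by rewrite /phi1 /pair_mx /hat !coordE //=; ring4.
by rewrite /phi0 /phi1 /pair_mx /hat !coordE //= ; ring4.
Qed.

Let t23_acts : acts_by (w + 1) t23.
Proof.
have ap : apart (pt 2) (pt 4) by rewrite apartE // !coordE.
apply: (@swap2_acts 2 4 (w + 1) (w + 1)) => // [||x|x sum0x]; rewrite ?swap2_mxE //.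
- by have /setIP[] : t23 \in P by rewrite even_young_cases !inE eqxx ?orbT.
- by apply: six_coordP; rewrite /b1 /b0 /pair_mx /hat !coordE //=; ring4.
- by rewrite /phi1 /pair_mx /hat !coordE //=; ring4.
by rewrite /phi0 /phi1 /pair_mx /hat !coordE //= sum6 //; ring4.
Qed.

Let t13_acts : acts_by w t13.
Proof.
have ap : apart (pt 0) (pt 4) by rewrite apartE // !coordE.
apply: (@swap2_acts 0 4 w (w + 1)) => // [||x|x sum0x]; rewrite ?swap2_mxE //.
- by have /setIP[] : t13 \in P by rewrite even_young_cases !inE eqxx ?orbT.
- by apply: six_coordP; rewrite /b1 /b0 /pair_mx /hat !coordE //=; ring4.
- by rewrite /phi1 /pair_mx /hat !coordE //=; ring4.
by rewrite /phi0 /phi1 /pair_mx /hat !coordE //= sum6 //; ring4.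
Qed.

Let w_neq0 : w != 0.
Proof. by apply: contra_eq_neq w2 => ->; rewrite mul0r add0r eq_sym oner_eq0. Qed.

Let w1_neq0 : w + 1 != 0.
Proof. by rewrite -w2 mulf_neq0. Qed.

(** The values 0, 1, w + 1 and w of c are distinct elements of the field with four elements, so
    every nontrivial element of P acts by a nontrivial unipotent matrix. *)
Let even_young_acts h : h \in P -> exists c, acts_by c h /\ (h != 1%g -> c != 0).
Proof.
rewrite even_young_cases !inE => /or4P[] /eqP->.
- exists 0; split=> [|]; last by case/eqP.
  have rE1 := repr_mx1 rE.
  by rewrite /acts_by !scale0r !addr0; split; rewrite ?rE1 ?mulmx1 ?mul1mx.
- by exists 1; split=> // _; rewrite oner_eq0.
- by exists (w + 1).
by exists w.
Qed.

(* The permutation (0 2)(1 3) exchanges the two summands of the restriction   *)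
(* of the module to P, so that the projections onto them are conjugate.       *)
Let y0 : 'S_6 := (tperm (pt 0) (pt 2) * tperm (pt 1) (pt 3))%g.

Let Gy0 : y0 \in G.
Proof. by apply: alt_tperm2; rewrite pt_eq. Qed.

Let y0E : ((y0 (pt 0) = pt 2) * (y0 (pt 1) = pt 3) * (y0 (pt 2) = pt 0)
  * (y0 (pt 3) = pt 1) * (y0 (pt 4) = pt 4) * (y0 (pt 5) = pt 5))%type.
Proof.
do !split; rewrite /y0 permM.
- by rewrite tpermL tpermD ?pt_eq.
- by rewrite (tpermD (z := pt 1)) ?tpermL ?pt_eq.
- by rewrite tpermR tpermD ?pt_eq.
- by rewrite (tpermD (z := pt 3)) ?tpermR ?pt_eq.
- by rewrite (tpermD (z := pt 4)) ?tpermD ?pt_eq.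
by rewrite (tpermD (z := pt 5)) ?tpermD ?pt_eq.
Qed.

Let b1E : ((b1 0 (pt 0) = 1) * (b1 0 (pt 1) = 0) * (b1 0 (pt 2) = w)
  * (b1 0 (pt 3) = 0) * (b1 0 (pt 4) = (w + 1)%R) * (b1 0 (pt 5) = 0))%type.
Proof. by do !split; rewrite !coordE //=; ring4. Qed.

Let b0E : ((b0 0 (pt 0) = 1) * (b0 0 (pt 1) = 1) * (b0 0 (pt 2) = w)
  * (b0 0 (pt 3) = w) * (b0 0 (pt 4) = 0) * (b0 0 (pt 5) = 0))%type.
Proof. by do !split; rewrite !coordE //=; ring4. Qed.

Let y0_inv : (y0 * y0 = 1)%g.
Proof.
have com : commute (tperm (pt 0) (pt 2)) (tperm (pt 1) (pt 3)).
  by apply/commgP/conjg_fixP; rewrite tpermJ !tpermD // pt_eq.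
have tt : (tperm (pt 0) (pt 2) * tperm (pt 0) (pt 2) = 1)%g by rewrite tperm2.
have uu : (tperm (pt 1) (pt 3) * tperm (pt 1) (pt 3) = 1)%g by rewrite tperm2.
move: com tt uu; rewrite /y0; move: (tperm _ _) (tperm _ _) => t u com tt uu.
by rewrite -mulgA (mulgA t) -com -mulgA ?tt ?uu mulg1 ?tt ?uu.
Qed.

Let proj : 'M[F]_d := f1 *m eB1 + f0 *m eB0.

Let proj_conj : proj + mxconj rE proj y0 = 1%:M.
Proof.
apply: eq_mulp => x sum0x.
have y0V : y0^-1%g = y0 by apply/eqP; rewrite eq_invg_mul y0_inv.
have projE x' : sum_zero x' -> x' *m p *m proj = (phi1 x' *: b1 + phi0 x' *: b0) *m p.
  move=> sum0x'; rewrite /proj mulmxDr (mulmxA _ f1) (mulmxA _ f0) f1E // f0E // !mul_scalar_mx.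
  by rewrite mulmxDl -!scalemxAl.
have sum0y := sum_zero_perm y0 sum0x.
have sum_proj x' : sum_zero (phi1 x' *: b1 + phi0 x' *: b0).
  by apply: sum_zeroD; apply: sum_zeroZ.
rewrite mulmx1 mulmxDr projE // /mxconj !mulmxA y0V -hom_p // projE // -hom_p //.
(* The two projections sum to x up to a constant. Both b1 and b0 vanish at the point 5, which [y0]
   fixes, so the constant is the coordinate of x there. *)
rewrite -mulmxDl; apply: (@eq_p _ x (x 0 (pt 5))) => //.
  by apply: sum_zeroD => //; apply: sum_zero_perm.
have comb a1 a0 k : (a1 *: b1 + a0 *: b0) 0 k = a1 * b1 0 k + a0 * b0 0 k.
  by move: b1 b0 => u1 u0; rewrite !mxE.
have x5 := sum6 sum0x.
have p1 : phi1 (x *m perm_mx y0)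
    = (w + 1) * (x 0 (pt 2) + x 0 (pt 3)) + (x 0 (pt 0) + x 0 (pt 1)).
  by rewrite /phi1 !row_perm_mxE y0V !y0E.
have p0 : phi0 (x *m perm_mx y0) = (w + 1) * x 0 (pt 2) + x 0 (pt 0) + w * x 0 (pt 4)
  + (x 0 (pt 2) + x 0 (pt 3)) + (w + 1) * (x 0 (pt 0) + x 0 (pt 1)).
  by rewrite /phi0 !row_perm_mxE y0V !y0E.
have coord k : (phi1 x *: b1 + phi0 x *: b0
      + (phi1 (x *m perm_mx y0) *: b1 + phi0 (x *m perm_mx y0) *: b0) *m perm_mx y0) 0 k
    = phi1 x * b1 0 k + phi0 x * b0 0 k + (phi1 (x *m perm_mx y0) * b1 0 (y0 k)
      + phi0 (x *m perm_mx y0) * b0 0 (y0 k)).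
  by rewrite [LHS]mxE row_perm_mxE y0V !comb.
have coord' k : (x + const_mx (x 0 (pt 5))) 0 k = x 0 k + x 0 (pt 5) by rewrite !mxE.
apply: six_coordP; rewrite coord coord' p1 p0 !y0E !b1E !b0E x5 /phi1 /phi0.
all: move: (x 0 (pt 0)) (x 0 (pt 1)) (x 0 (pt 2)) (x 0 (pt 3)) (x 0 (pt 4)) => z0 z1 z2 z3 z4.
all: ring4.
Qed.

Let swap_y0 : (((swap (pt 0) ^ y0)%g = swap (pt 2)) * ((swap (pt 2) ^ y0)%g = swap (pt 0))
  * ((swap (pt 4) ^ y0)%g = swap (pt 4)))%type.
Proof. by do !split; rewrite !swapE //= tpermJ !y0E. Qed.

Let norm_y0 : y0 \in 'N(P).
Proof.
rewrite inE; apply/subsetP=> _ /imsetP[h Ph ->]; move: Ph; rewrite even_young_cases.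
rewrite 3!in_cons mem_seq1 => /or4P[] /eqP->; rewrite ?conj1g ?group1 //.
- suff -> : (t12 ^ y0)%g = t12 by rewrite even_young_cases !inE eqxx ?orbT.
  by rewrite /t12 conjMg !swap_y0; apply: swap_commute.
- suff -> : (t23 ^ y0)%g = t13 by rewrite even_young_cases !inE eqxx ?orbT.
  by rewrite /t23 conjMg !swap_y0.
suff -> : (t13 ^ y0)%g = t23 by rewrite even_young_cases !inE eqxx ?orbT.
by rewrite /t13 conjMg !swap_y0.
Qed.

Let notP_y0 : y0 \notin P.
Proof.
have y00 : y0 (pt 0) = pt 2 by rewrite y0E.
apply/negP; rewrite even_young_cases 3!in_cons mem_seq1 => /or4P[] /eqP E;
  have := y00; rewrite E; apply/eqP.
- by rewrite perm1 pt_eq.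
- by rewrite permM !swapE //= tpermL tpermD ?pt_eq.
- by rewrite permM !swapE //= !(tpermD (z := pt 0)) ?pt_eq.
by rewrite permM !swapE //= tpermL tpermD ?pt_eq.
Qed.

Let equivariant_proj : equivariant rE P proj.
Proof.
move=> h /even_young_acts[c [[E1 E0 Ef1 Ef0] _]].
rewrite /proj (mulmxDr (rE h)) (mulmxDl _ _ (rE h)).
rewrite (mulmxA (rE h) f1) (mulmxA (rE h) f0) -(mulmxA f1 eB1) -(mulmxA f0 eB0).
rewrite Ef1 Ef0 E1 E0 (mulmxDl f0) (mulmxDr f1) -scalemxAl -scalemxAr.
by rewrite addrA addrAC.
Qed.

Let sPG : P \subset G. Proof. exact: subsetIr. Qed.

(** P and [y0] generate a group K of order 8, and the trace from P to K is [proj] plus its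
    conjugate, that is 1. The index 360 / 8 = 45 of K is odd, so the trace from K to G is again
    1. *)
Let trace_proj : rel_trace rE P G proj = 1%:M.
Proof.
pose K := (P <*> <[y0]>)%G.
have sPK : P \subset K by apply: joing_subl.
have Ky0 : y0 \in K by apply: (subsetP (joing_subr _ _)); apply: cycle_id.
have sKG : K \subset G by rewrite join_subG sPG cycle_subG.
have order_y0 : #[y0]%g = 2.
  apply: nt_prime_order; rewrite // ?expgS ?expg0 ?mulg1 ?y0_inv //.
  by apply: contraNneq notP_y0 => ->; apply: group1.
have cardK : #|K| = 8.
  rewrite /= norm_joinEr ?cycle_subG // TI_cardMg ?card_even_young -?orderE ?order_y0 //.
  apply/trivgP/subsetP=> h /setIP[Ph]; rewrite /= cycle2g // !inE => /orP[// | /eqP Eh].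
  by case/negP: notP_y0; rewrite -Eh.
have iKP : #|K : P| = 2 by rewrite -divgS // cardK card_even_young.
have oddGK : odd #|G : K|.
  have cardG : #|G| = 360.
    have := card_Alt (T := 'I_6); rewrite card_ord => /(_ isT) E.
    by apply/eqP; rewrite -(eqn_pmul2l (isT : 0 < 2)%N) E.
  by rewrite -divgS // cardG cardK.
rewrite (rel_trace_trans sPK sKG (subxx G) equivariant_proj).
rewrite (rel_trace_index2 sPK sKG iKP Ky0 notP_y0 equivariant_proj) proj_conj.
by rewrite rel_trace1 //; congr (_%:M); apply: (@mulrn_odd _ F^o).
Qed.

Let A : 'M[F]_(d, 1 + 1) := row_mx f1 f0.
Let B : 'M[F]_(1 + 1, d) := col_mx eB1 eB0.
Let T (c : F) : 'M[F]_(1 + 1) := block_mx 1%:M c%:M 0 1%:M.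

Let eB0f0 : eB0 *m f0 = 1%:M.
Proof.
rewrite f0E //; congr (_%:M); rewrite /phi0 !b0E.
ring4.
Qed.

Let BA1 : B *m A = 1%:M.
Proof.
rewrite mul_col_row eB0f0 !f1E // f0E // scalar_mx_block; congr block_mx.
- by congr (_%:M); rewrite /phi1 !b1E; ring4.
- by rewrite (_ : phi0 b1 = 0) ?raddf0 //; rewrite /phi0 !b1E; ring4.
by rewrite (_ : phi1 b0 = 0) ?raddf0 //; rewrite /phi1 !b0E; ring4.
Qed.

Let T_act h c : acts_by c h -> B *m rE h = T c *m B /\ rE h *m A = A *m T c.
Proof.
case=> E1 E0 Ef1 Ef0; split.
  by rewrite mul_col_mx mul_block_col E1 E0 !mul1mx mul_scalar_mx mul0mx add0r.
by rewrite mul_mx_row mul_row_block Ef1 Ef0 !mulmx1 mul_mx_scalar mulmx0 addr0 addrC.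
Qed.

Let BE h : h \in P -> B *m rE h *m A *m B = B *m rE h.
Proof.
case/even_young_acts=> c [/T_act[E _] _].
by rewrite E -[_ *m B *m A]mulmxA BA1 mulmx1.
Qed.

Let source_mx_repr : mx_repr P (fun h => B *m rE h *m A).
Proof.
split=> [|g h Pg Ph]; first by rewrite repr_mx1 mulmx1.
by rewrite !mulmxA BE // repr_mxM ?(subsetP sPG) // !mulmxA.
Qed.

Let rS := MxRepresentation source_mx_repr.

Let rS_T c h : acts_by c h -> rS h = T c.
Proof. by move=> /T_act[E _]; rewrite /= E -mulmxA BA1 mulmx1. Qed.

(** The commutant of a unipotent 2 x 2 Jordan block consists of the matrices with equal diagonal
    entries and zero lower left entry; its idempotents are 0 and 1. *)
Let indecomposable_T (H : {group 'S_6}) (rX : mx_representation F H (1 + 1)) h :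
  h \in H -> rX h = T 1 -> indecomposable rX.
Proof.
move=> Hh rXh; apply: indecomposable_idempotent => // th eqv.
have := eqv h Hh; rewrite rXh -[th]submxK.
move: (ulsubmx th) (ursubmx th) (dlsubmx th) (drsubmx th) => a b c e.
rewrite !mulmx_block !mul0mx !mul1mx !mulmx1 !mulmx0 !addr0 !add0r => /eq_block_mx[].
move/(canRL (addKr _)); rewrite addNr => -> E _ _; move: E.
rewrite addrC => /addIr->; rewrite mulmx0 addr0 => /eq_block_mx[aa ab _ _].
have b0' : b = 0.
  rewrite -ab [a]mx11_scalar mul_scalar_mx mul_mx_scalar addvv_pchar2 //.
rewrite b0'; move: aa; rewrite [a]mx11_scalar -scalar_mxM => /matrixP/(_ 0 0).
rewrite !mxE eqxx !mulr1n => /eqP; rewrite -subr_eq0 -{3}[a 0 0]mulr1 -mulrBr mulf_eq0.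
case/orP=> [/eqP-> | ]; [left | rewrite subr_eq0 => /eqP->; right].
  by rewrite raddf0 block_mx0.
by rewrite scalar_mx_block.
Qed.

Lemma six_natural_vertex (Q : {group 'S_6}) : is_vertex rE Q ->
  conjugate_in 'Alt_('I_6) Q (Young_222 6 :&: 'Alt_('I_6))
  /\ exists rX : mx_representation F Q 2, is_source rE rX.
Proof.
move=> vxQ.
have homA : {in P, forall h, rE h *m A = A *m rS h}.
  by move=> h /even_young_acts[c [acts _]]; rewrite (rS_T acts); case: (T_act acts).
have homB : {in P, forall h, rS h *m B = B *m rE h}.
  by move=> h /even_young_acts[c [acts _]]; rewrite (rS_T acts); case: (T_act acts).
have AB : A *m B = proj by rewrite mul_row_col.
have tr1 : rel_trace rE P G (A *m B) = 1%:M by rewrite AB.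
have nz_vf : eB0 *m f0 != 0 by rewrite eB0f0 oner_eq0.
have key (R : {group 'S_6}) (x : 'S_6) th : maximal R P -> x \in P -> x \notin R ->
    equivariant rE R th -> eB0 *m (th + mxconj rE th x) *m f0 = 0.
  move=> maxR Px _ eqR.
  have sRP := proper_sub (maxgroupp maxR).
  have ntR : R :!=: 1%g.
    apply/eqP=> R1; have := p_maximal_index even_young_pgroup maxR.
    by rewrite R1 indexg1 card_even_young.
  have [r Rr ntr] := trivgPn _ ntR.
  have [c [[E1 E0 Ef1 _] /(_ ntr) nz_c]] := even_young_acts (subsetP sRP r Rr).
  have [c' [[_ E0' _ Ef0'] _]] := even_young_acts Px.
  (* R has index 2 in a group of order 4, so it contains some r <> 1. Moving r past th from b1 to
     f1, both of whose images are known, leaves c times this scalar with c nonzero. Hence the term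
     by which x changes f0 contributes nothing. *)
  have th_f1 : eB0 *m th *m f1 = 0.
    have : (eB1 + c *: eB0) *m th *m f1 = eB1 *m th *m f1.
      by rewrite -E1 -[eB1 *m _ *m th]mulmxA eqR // mulmxA -mulmxA Ef1.
    rewrite (mulmxDl _ _ th) mulmxDl -!scalemxAl -[RHS]addr0 => /addrI.
    by move/eqP; rewrite scaler_eq0 (negPf nz_c) => /eqP.
  have E0V : eB0 *m rE x^-1%g = eB0 by rewrite -{1}E0' repr_mxK ?(subsetP sPG).
  rewrite (mulmxDr eB0) (mulmxDl _ _ f0) /mxconj (mulmxA eB0 _ (rE x)).
  rewrite (mulmxA eB0 _ th) E0V -(mulmxA _ (rE x) f0) Ef0' (mulmxDr (eB0 *m th)).
  by rewrite -scalemxAr th_f1 scaler0 addr0 addvv_pchar2.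
have [g Gg defQ] := vertex_conj sPG homA homB tr1 even_young_pgroup nz_vf key vxQ.
split; first by exists g.
have {}defQ : Q = (P :^ g)%G by apply: group_inj.
subst Q; exists (conj_repr rS g); split; last first.
  by apply: (direct_summand_ind_conj sPG homA homB tr1 Gg) => x Px; rewrite /= conjgK.
apply: (@indecomposable_T _ _ (t12 ^ g)%g); last by rewrite /= conjgK; apply: (rS_T t12_acts).
by rewrite memJ_conjg even_young_cases !inE eqxx orbT.
Qed.

End DegreeSix.

(** * Degree 4 *)

Section SmallDegree.

Local Open Scope group_scope.

Local Notation pt := (inord : nat -> 'I_4).

Let pt_eq k l : (k < 4)%N -> (l < 4)%N -> (pt k == pt l) = (k == l).
Proof. by move=> k4 l4; rewrite -val_eqE /= !inordK. Qed.

Let o0 := pt 0%N. Let o1 := pt 1%N. Let o2 := pt 2%N. Let o3 := pt 3%N.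

Let uniq_t : uniq [:: o0; o1; o2; o3]. Proof. by rewrite /= !inE !pt_eq. Qed.
Let uniq_u : uniq [:: o0; o2; o1; o3]. Proof. by rewrite /= !inE !pt_eq. Qed.
Let uniq_v : uniq [:: o0; o3; o1; o2]. Proof. by rewrite /= !inE !pt_eq. Qed.

Let t : 'S_4 := (tperm o0 o1 * tperm o2 o3)%g.
Let u : 'S_4 := (tperm o0 o2 * tperm o1 o3)%g.
Let v : 'S_4 := (tperm o0 o3 * tperm o1 o2)%g.
Let g : 'S_4 := (tperm o0 o1 * tperm o0 o2)%g.

Let tuJ : t ^ u = t.
Proof.
have [u0 u2 u1 u3] := tperm2_values uniq_u.
by rewrite {1}/t conjMg !tpermJ u0 u1 u2 u3 -(tperm_commute uniq_t).
Qed.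

Let tvJ : t ^ v = t.
Proof.
have [v0 v3 v1 v2] := tperm2_values uniq_v.
rewrite {1}/t conjMg !tpermJ v0 v1 v2 v3 (tpermC o3 o2) (tpermC o1 o0).
by rewrite -(tperm_commute uniq_t).
Qed.

Let uvJ : u ^ v = u.
Proof.
have [v0 v3 v1 v2] := tperm2_values uniq_v.
rewrite {1}/u conjMg !tpermJ v0 v1 v2 v3 (tpermC o3 o1) (tpermC o2 o0).
by rewrite -(tperm_commute uniq_u).
Qed.

Let gE : [/\ g o0 = o1, g o1 = o2, g o2 = o0 & g o3 = o3].
Proof.
split; rewrite permM.
- by rewrite tpermL tpermD ?pt_eq.
- by rewrite tpermR tpermL.
- by rewrite (tpermD (z := o2)) ?tpermR ?pt_eq.
by rewrite (tpermD (z := o3)) ?tpermD ?pt_eq.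
Qed.

Let S := [set t; u; v].

Let gJ : S :^ g \subset S.
Proof.
have [g0 g1 g2 g3] := gE.
have tg : t ^ g = v by rewrite /t conjMg !tpermJ g0 g1 g2 g3 -(tperm_commute uniq_v).
have ug : u ^ g = t by rewrite /u conjMg !tpermJ g0 g1 g2 g3 (tpermC o1 o0).
have vg : v ^ g = u.
  by rewrite /v conjMg !tpermJ g0 g1 g2 g3 (tpermC o2 o0) -(tperm_commute uniq_u).
apply/subsetP=> _ /imsetP[x + ->]; rewrite !inE => /orP[/orP[]|] /eqP->;
  by rewrite ?tg ?ug ?vg eqxx ?orbT.
Qed.

Let K := <<S>>%G.

Let double_tperm_inv a b c d : uniq [:: a; b; c; d] ->
  (tperm a b * tperm c d * (tperm a b * tperm c d) = 1 :> 'S_4)%g.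
Proof.
move/tperm_commute; have := tperm2 a b; have := tperm2 c d.
move: (tperm a b) (tperm c d) => x y yy xx com.
by rewrite {2}com mulgA -(mulgA x) yy mulg1.
Qed.

Let abelK : 2.-abelem K.
Proof.
apply: gen_involutions_abelem => [x y|x].
  have com (x' y' : 'S_4) : x' ^ y' = x' -> commute x' y'.
    by move=> fix_x; apply/commgP/conjg_fixP.
  rewrite !inE => /orP[/orP[]|] /eqP-> /orP[/orP[]|] /eqP-> //;
    by [apply: com | apply/commute_sym/com].
by rewrite !inE => /orP[/orP[]|] /eqP->; apply: double_tperm_inv.
Qed.

Let memK x : x \in S -> x \in K. Proof. exact: mem_gen. Qed.

Let sKG : K \subset 'Alt_('I_4).
Proof.
rewrite gen_subG; apply/subsetP=> x Sx; rewrite Alt_even; move: Sx.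
by rewrite !inE => /orP[/orP[]|] /eqP->; rewrite odd_permM !odd_tperm !pt_eq.
Qed.

Let cardG : #|'Alt_('I_4)| = 12.
Proof.
have := card_Alt (T := 'I_4); rewrite card_ord => /(_ isT) E.
by apply/eqP; rewrite -(eqn_pmul2l (isT : 0 < 2)%N) E.
Qed.

(** The order of this 2-group divides 12 and exceeds 2. *)
Let cardK : #|K| = 4.
Proof.
have tuv : uniq [:: 1; t; u]%g.
  have [t0 _ _ _] := tperm2_values uniq_t; have [u0 _ _ _] := tperm2_values uniq_u.
  have neq (x y : 'S_4) : x o0 != y o0 -> x != y by apply: contra => /eqP->.
  by rewrite /= !inE negb_or !neq ?perm1 ?t0 ?u0 ?pt_eq.
have gt2 : (2 < #|K|)%N.
  apply: (@leq_trans #|[:: 1; t; u]%g|); first by rewrite (card_uniqP tuv).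
  apply/subset_leq_card/subsetP=> x.
  rewrite !inE => /or3P[] /eqP->; rewrite ?group1 ?memK // !inE eqxx ?orbT //.
have dvd12 := cardSg sKG; rewrite cardG in dvd12.
have := abelem_pgroup abelK; rewrite /pgroup => nat2.
have : #|K| \in divisors 12 by rewrite -dvdn_divisors.
rewrite !inE => /or4P[||| /or3P[]] /eqP E; move: gt2 nat2; rewrite E //.
Qed.

(** The 3-cycle g permutes the three double transpositions, so the normaliser in A_4 is strictly
    larger than K; its order is a multiple of 4 dividing 12, hence 12. *)
Let normalK : K <| 'Alt_('I_4).
Proof.
rewrite /normal sKG /=.
have Gg : g \in 'Alt_('I_4) by apply: alt_tperm2; rewrite pt_eq.
have Ng : g \in 'N(K) by rewrite inE -genJ gen_subG (subset_trans gJ) ?subset_gen.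
have [g0 g1 g2 g3] := gE.
pose N := ('N(K) :&: 'Alt_('I_4))%G.
have sKN : K \subset N by rewrite subsetI normG.
have ltKN : (#|K| < #|N|)%N.
  apply: proper_card; rewrite properE sKN; apply/subsetPn; exists g; first by rewrite inE Ng.
  apply/negP=> Kg; have [_ /(_ g Kg)] := abelemP (isT : prime 2) abelK.
  by rewrite expgS expg1 => /permP/(_ o0); rewrite permM g0 g1 perm1 => /eqP; rewrite pt_eq.
have dvd4 := cardSg sKN; rewrite cardK in dvd4.
have dvd12 := cardSg (subsetIr 'N(K) 'Alt_('I_4)); rewrite cardG in dvd12.
have cardN : #|N| = 12.
  move: ltKN dvd4; rewrite cardK; have : #|N| \in divisors 12 by rewrite -dvdn_divisors.
  by rewrite !inE => /or4P[||| /or3P[]] /eqP->.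
have /setIidPr : N :=: 'Alt_('I_4).
  by apply/eqP; rewrite eqEcard subsetIr cardG cardN.
by [].
Qed.

Lemma alt4_normal_sylow : exists2 P : {group 'S_4},
  2.-Sylow('Alt_('I_4)) P & P <| 'Alt_('I_4).
Proof.
exists K; last exact: normalK.
by rewrite pHallE sKG /= cardK cardG p_part.
Qed.

End SmallDegree.

Lemma closed_field_omega (F : closedFieldType) : (2%N \in [pchar F])%R ->
  exists w : F, w * w = w + 1.
Proof.
(* With both coefficients equal to 1, the root satisfies w ^+ 2 = 1 + w, so in characteristic 2 it
   is a primitive cube root of unity. *)
move=> char2; have [w] := @solve_monicpoly F 2 (fun=> 1) isT.
rewrite !big_ord_recl big_ord0 /= !mul1r addr0 expr0 expr1 => Ew.
by exists w; rewrite -expr2 Ew addrC.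
Qed.

Local Close Scope ring_scope.
Local Open Scope group_scope.

Theorem theorem1p1 (F : closedFieldType) (charF2 : 2%N \in [pchar F]%R)
    (n : nat) (n_ge3 : (3 <= n)%N)
    (d : nat) (rE : mx_representation F 'Alt_('I_n) d)
    (natE : natural_simple rE)
    (Q : {group 'S_n}) (sQA : Q \subset 'Alt_('I_n)) (vertexQ : is_vertex rE Q) :
  [/\ odd n ->
        (exists2 P : {group 'S_n}, 2.-Sylow(Alt_n_minus_3 n) P
           & conjugate_in 'Alt_('I_n) Q P)
        /\ trivial_source rE Q,
      (6 < n)%N -> ~~ odd n ->
        2.-Sylow('Alt_('I_n)) Q /\ is_source rE (subg_repr rE sQA),
      n = 4 ->
        'Syl_2('Alt_('I_n)) = [set Q] /\ trivial_source rE Q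
    & n = 6 ->
        conjugate_in 'Alt_('I_n) Q (Young_222 n :&: 'Alt_('I_n))
        /\ (exists rS : mx_representation F Q 2, is_source rE rS)].
Proof.
have [irrE _] := composition_factor_quotient (proj1 natE).
split=> [n_odd | n_gt6 n_even | n4 | n6].
- have [n_lt5 | n_ge5] := ltnP n 5; last first.
    have [p [q model]] := natural_simple_model charF2 n_ge5 natE.
    have [P sylP] := Sylow_exists 2 (Alt_n_minus_3 n).
    have [conjQ trivQ] := odd_natural_vertex charF2 n_ge5 n_odd model sylP vertexQ.
    by split=> //; exists P.
  (* The remaining odd case is n = 3, where A_3 has order 3 and the trivial group is a normal Sylow
     2-subgroup, both of A_3 and of [Alt_n_minus_3 3]. *)
  have n3 : n = 3 by move: n_ge3 n_lt5 n_odd; case: (n) => [|[|[|[|[]]]]].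
  subst n.
  have cardG : #|'Alt_('I_3)| = 3.
    have := card_Alt (T := 'I_3); rewrite card_ord => /(_ isT) E.
    by apply/eqP; rewrite -(eqn_pmul2l (isT : 0 < 2)%N) E.
  have syl1 (H : {group 'S_3}) : H \subset 'Alt_('I_3) -> 2.-Sylow(H) 1%G.
    move=> /cardSg; rewrite cardG pHallE sub1G /= cards1 => dvd3.
    have : #|H| \in divisors 3 by rewrite -dvdn_divisors.
    by rewrite !inE => /orP[] /eqP->; rewrite p_part.
  have [Q1 trivQ] := normal_sylow_vertex charF2 irrE (syl1 _ (subxx _)) (normal1 _) vertexQ.
  split=> //; exists 1%G; first by apply: syl1; apply: subsetIl.
  by exists 1%g; rewrite ?group1 // conjsg1.
- have n_ge8 : (8 <= n)%N by move: n_gt6 n_even; rewrite leq_eqVlt => /orP[/eqP<-|].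
  have n_ge5 : (5 <= n)%N by apply: leq_trans n_ge8.
  have [p [q model]] := natural_simple_model charF2 n_ge5 natE.
  exact: even_natural_vertex charF2 n_even n_ge8 model Q sQA vertexQ.
- subst n; have [P sylP nsP] := alt4_normal_sylow.
  have [defQ trivQ] := normal_sylow_vertex charF2 irrE sylP nsP vertexQ.
  (* A normal Sylow subgroup is the only one. *)
  split=> //; have : #|'Syl_2('Alt_('I_4))| == 1%N by apply/normal_sylowP; exists P.
  case/cards1P=> R defS; rewrite defS; congr [set _].
  have : P \in 'Syl_2('Alt_('I_4)) by rewrite inE.
  by rewrite defS inE => /eqP <-; apply: group_inj.
subst n; have [w w2] := closed_field_omega charF2.
have [p [q model]] := natural_simple_model charF2 (isT : 5 <= 6)%N natE.
exact: six_natural_vertex charF2 w2 model Q vertexQ.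
Qed.
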